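(* Let $(\mathcal A,*,\phi)$ be a $*$-probability space satisfying the growth condition with respect to a generating set $S\subset\mathcal A_{sa}$. Let $(\pi_1,\alpha_1,\xi_1)$ and $(\pi_2,\alpha_2,\xi_2)$ be representations of $\mathcal A$ (with respect to $S$) on Hilbert spaces $H_1$ and $H_2$. Let $\mathcal N_1$ and $\mathcal N_2$ be the von Neumann algebras generated by the spectral projections of $\{\pi_1(x)\}_{x\in S}$ and of $\{\pi_2(x)\}_{x\in S}$, respectively. Assume in addition that the restrictions $\phi_1(x)=(\xi_1,x\xi_1)$ and $\phi_2(x)=(\xi_2,x\xi_2)$ are faithful on $\mathcal N_1$ and $\mathcal N_2$, respectively. Then there is a normal homomorphism $\pi:\mathcal N_1\to\mathcal N_2$ such that $\phi_2\circ\pi=\phi_1$.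
   Context: A $*$-probability space $(\mathcal A,*,\phi)$ is a unital complex $*$-algebra $\mathcal A$ with a linear functional $\phi:\mathcal A\to\mathbb C$ such that $\phi(1)=1$, $\phi(a^*a)\ge0$ and $\phi(a^* )=\overline{\phi(a)}$. $\mathcal A_{sa}=\{a\in\mathcal A:a^*=a\}$. Growth condition with respect to $S\subset\mathcal A_{sa}$: $S\cup\{1\}$ generates $\mathcal A$ as an algebra and there is a function $|\cdot|:S\to(0,\infty)$ with $|\phi(a_1\cdots a_n)|\le n^n\prod_{i=1}^n|a_i|$ for all $n$ and $a_1,\dots,a_n\in S$. A representation $(\pi,\alpha,\xi)$ of $\mathcal A$ (with generating set $S$) consists of: (i) a Hilbert space $H$, a unit vector $\xi\in H$ and a linear map $\alpha:\mathcal A\to H$ with $\alpha(1)=\xi$; (ii) a map $\pi$ from $S\cup\{1\}$ into the selfadjoint densely defined operators on $H$ with $\pi(1)=1$, such that $\alpha(\mathcal A)$ is contained in the domain of $\pi(a)^k$ for all $a\in S$, $k\in\mathbb N$, and such that for all $a\in S$ with spectral resolution $E_t^{\pi(a)}$ and all $b\in\mathcal A$, $k\in\mathbb N$: $\pi(a)\xi=\alpha(a)$ and $\int t^k(\alpha(b),dE_t^{\pi(a)}\alpha(b))=(\alpha(b),\alpha(a^kb))$; (iii) $\phi(a^*b)=(\alpha(a),\alpha(b))_H$ for all $a,b\in\mathcal A$. Inner products are antilinear in the first variable. *)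

(* Defs.v *)
From HB Require Import structures.
From mathcomp Require Import all_boot all_order all_algebra.
From mathcomp Require Import complex.
From mathcomp Require Import all_classical all_reals all_analysis.

Set Implicit Arguments.
Unset Strict Implicit.
Unset Printing Implicit Defensive.
Import Order.TTheory GRing.Theory Num.Theory.
Import numFieldNormedType.Exports.
Local Open Scope classical_set_scope.
Local Open Scope ring_scope.
Local Open Scope complex_scope.

Record star_algebra (R : realType) (A : algType R[i]) (star : A -> A) : Prop := {
  star_add : forall a b, star (a + b) = star a + star b;
  star_scale : forall (c : R[i]) a, star (c *: a) = c^* *: star a;
  star_mul : forall a b, star (a * b) = star b * star a;
  star_invol : involutive star }.

Record star_probability_space (R : realType) (A : algType R[i])
    (star : A -> A) (phi : {scalar A}) : Prop := {
  sps_star : star_algebra star;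
  sps_unit : phi 1 = 1;
  sps_pos : forall a, 0 <= phi (star a * a);
  sps_conj : forall a, phi (star a) = (phi a)^* }.

(* [0 ^ 0 = 1], so the bound for the empty word reads [`|phi 1| <= 1]. *)
Record growth_condition (R : realType) (A : algType R[i])
    (phi : {scalar A}) (S : set A) : Prop := {
  growth_generates : forall B : {pred A}, GRing.subalg_closed B ->
    (forall a, S a -> a \in B) -> forall a, a \in B;
  growth_bound : exists2 w : A -> R, forall a, S a -> 0 < w a &
    forall s : seq A, (forall a, a \in s -> S a) ->
      `|phi (\prod_(a <- s) a)| <= ((size s ^ size s)%:R * \prod_(a <- s) w a)%:C }.

Record hilbert (R : realType) := Hilbert {
  hilbert_sort :> completeNormedModType R[i];
  ip : hilbert_sort -> hilbert_sort -> R[i];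
  ip_scalar : forall x, scalar (ip x);
  ip_conj : forall x y, ip y x = (ip x y)^*;
  ip_norm : forall x, `|x| ^+ 2 = ip x x }.

Section Bounded.
Variables (R : realType) (H : hilbert R).
Implicit Types (T U : H -> H) (M F : set (H -> H)).

Definition bounded_operator T : Prop := linear T /\ continuous T.

Definition adjoint T U : Prop := forall x y, ip x (T y) = ip (U x) y.

(* In [R[i]], [0 <= z] means that [z] is real and nonnegative. *)
Definition op_le T U : Prop := forall x, 0 <= ip x (U x - T x).

Definition orth_projection P : Prop :=
  [/\ bounded_operator P, P \o P = P & adjoint P P].

Definition commutant M : set (H -> H) :=
  [set T | bounded_operator T /\ forall U, M U -> T \o U = U \o T].

Record von_neumann_algebra M : Prop := {
  vna_bounded : M `<=` bounded_operator;
  vna_id : M id;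
  vna_add : forall T U, M T -> M U -> M (fun x => T x + U x);
  vna_scale : forall (c : R[i]) T, M T -> M (fun x => c *: T x);
  vna_comp : forall T U, M T -> M U -> M (T \o U);
  vna_adjoint : forall T, M T -> exists2 U, M U & adjoint T U;
  vna_bicommutant : commutant (commutant M) = M }.

Definition vna_generated X : set (H -> H) :=
  [set T | forall M, von_neumann_algebra M -> X `<=` M -> M T].

Definition vector_state (xi : H) T : R[i] := ip xi (T xi).

Definition faithful (omega : (H -> H) -> R[i]) M : Prop :=
  forall T U, M T -> M U -> adjoint T U -> omega (U \o T) = 0 -> T = (fun=> 0).

Definition op_lub M F T : Prop :=
  [/\ M T, forall U, F U -> op_le U T
    & forall V, M V -> (forall U, F U -> op_le U V) -> op_le T V].

Definition op_directed F : Prop :=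
  F !=set0 /\ forall T U, F T -> F U ->
    exists V, [/\ F V, op_le T V & op_le U V].

End Bounded.

Record vna_morphism (R : realType) (H1 H2 : hilbert R)
    (M1 : set (H1 -> H1)) (M2 : set (H2 -> H2))
    (f : (H1 -> H1) -> (H2 -> H2)) : Prop := {
  vnam_map : forall T, M1 T -> M2 (f T);
  vnam_id : f id = id;
  vnam_add : forall T U, M1 T -> M1 U ->
    f (fun x => T x + U x) = (fun x => f T x + f U x);
  vnam_scale : forall (c : R[i]) T, M1 T ->
    f (fun x => c *: T x) = (fun x => c *: f T x);
  vnam_comp : forall T U, M1 T -> M1 U -> f (T \o U) = f T \o f U;
  vnam_adjoint : forall T U, M1 T -> M1 U -> adjoint T U ->
    adjoint (f T) (f U) }.

(* Dixmier's definition: suprema of bounded increasing families of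
   selfadjoint elements are preserved. *)
Definition normal_map (R : realType) (H1 H2 : hilbert R)
    (M1 : set (H1 -> H1)) (M2 : set (H2 -> H2))
    (f : (H1 -> H1) -> (H2 -> H2)) : Prop :=
  forall (F : set (H1 -> H1)) T,
    F `<=` [set U | M1 U /\ adjoint U U] -> op_directed F ->
    op_lub M1 F T -> op_lub M2 (f @` F) (f T).

Section Unbounded.
Variables (R : realType) (H : hilbert R).

(* The values of [op_fun] outside [op_dom] are irrelevant. *)
Record unbounded_operator := UnboundedOperator {
  op_dom : set H;
  op_fun :> H -> H }.

Implicit Type T : unbounded_operator.

Fixpoint op_dom_pow T k : set H :=
  if k is k'.+1 then [set x | op_dom T x /\ op_dom_pow T k' (T x)] else setT.

(* The last field says that [T] and its adjoint have the same graph: the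
   left-hand side states that [y] is in the domain of the adjoint, with image
   [z]. *)
Record selfadjoint T : Prop := {
  sa_dom0 : op_dom T 0;
  sa_linear : forall (c : R[i]) x y, op_dom T x -> op_dom T y ->
    op_dom T (c *: x + y) /\ T (c *: x + y) = c *: T x + T y;
  sa_dense : dense (op_dom T);
  sa_adjoint : forall y z,
    (forall x, op_dom T x -> ip y (T x) = ip z x) <->
    (op_dom T y /\ T y = z) }.

Record resolution_of_identity := ResolutionOfIdentity {
  roi :> R -> H -> H;
  roi_proj : forall t, orth_projection (roi t);
  roi_mono : forall s t, s <= t -> op_le (roi s) (roi t);
  roi_right : forall t x, roi s x @[s --> t^'+] --> roi t x;
  roi_ninfty : forall x, roi s x @[s --> -oo] --> (0 : H);
  roi_pinfty : forall x, roi s x @[s --> +oo] --> x }.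

Definition roi_fun (E : resolution_of_identity) (x : H) (t : R) : R :=
  complex.Re (ip x (E t x)).

Let roi_fun_nd E x : {homo roi_fun E x : s t / s <= t}.
Proof.
move=> s t st; have := roi_mono E st x; rewrite /roi_fun lecE => /andP[_] /=.
have -> : ip x (E t x - E s x) = ip x (E t x) - ip x (E s x).
  by rewrite addrC -scaleN1r (ip_scalar x) mulN1r addrC.
by rewrite raddfB /= subr_ge0.
Qed.

Let roi_fun_rc E x : right_continuous (roi_fun E x).
Proof.
move=> t.
have fE s : roi_fun E x s = complex.Re (`|E s x| ^+ 2).
  have [_ PP Padj] := roi_proj E s.
  by rewrite ip_norm Padj -[E s (E s x)]/((E s \o E s) x) PP -Padj.
have h : `|E s x| ^+ 2 @[s --> t^'+] --> `|E t x| ^+ 2.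
  by rewrite !expr2; apply: cvgM; apply: cvg_norm; exact: roi_right.
apply/cvgrPdist_lt => e e0.
have e0' : 0 < e%:C :> R[i] by rewrite ltcR.
move/cvgrPdist_lt : h => /(_ _ e0'); apply: filterS => s.
rewrite !fE => h; rewrite -ltcR; apply: le_lt_trans h.
by rewrite -raddfB; exact: normc_ge_Re.
Qed.

HB.instance Definition _ E x :=
  isCumulative.Build R _ R (roi_fun E x) (@roi_fun_nd E x) (@roi_fun_rc E x).

(* The measure [d(x, E_t x)] on the real line. *)
Definition spectral_measure (E : resolution_of_identity) (x : H) :
    {measure set (measurableTypeR R) -> \bar R} :=
  lebesgue_stieltjes_measure (roi_fun E x).

(* [T] is the integral of [t] against [dE_t], a weak integral determined by its
   diagonal values: the domain consists of the [x] for which [t ^ 2] has a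
   finite integral against [d(x, E_t x)], and there [(x, T x)] is the integral
   of [t]. *)
Record spectral_resolution T (E : resolution_of_identity) : Prop := {
  sr_dom : forall x, op_dom T x <->
    (\int[spectral_measure E x]_t (t ^+ 2)%:E < +oo)%E;
  sr_val : forall x, op_dom T x ->
    ip x (T x) = (\int[spectral_measure E x]_t t)%:C }.

End Unbounded.

(* The spectral resolutions are named by [rep_res]; each of them exists and is
   determined by the operator, by the spectral theorem. The values of [rep_op]
   and [rep_res] outside [S] and [1] are irrelevant. *)
Record representation (R : realType) (A : algType R[i]) (star : A -> A)
    (phi : {scalar A}) (S : set A) := Representation {
  rep_space : hilbert R;
  rep_vec : rep_space;
  rep_map : {linear A -> rep_space};
  rep_op : A -> unbounded_operator rep_space;
  rep_res : A -> resolution_of_identity rep_space;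
  rep_vec_unit : `|rep_vec| = 1;
  rep_map1 : rep_map 1 = rep_vec;
  rep_op_sa : forall a, S a \/ a = 1 -> selfadjoint (rep_op a);
  rep_op1 : op_dom (rep_op 1) = setT /\ forall x, rep_op 1 x = x;
  rep_dom : forall a k b, S a -> op_dom_pow (rep_op a) k (rep_map b);
  rep_resP : forall a, S a -> spectral_resolution (rep_op a) (rep_res a);
  rep_op_vec : forall a, S a -> rep_op a rep_vec = rep_map a;
  rep_moment : forall a b k, S a ->
    let mu := spectral_measure (rep_res a) (rep_map b) in
    mu.-integrable setT (fun t => (t ^+ k)%:E) /\
    (\int[mu]_t (t ^+ k))%:C = ip (rep_map b) (rep_map (a ^+ k * b));
  rep_phi : forall a b, phi (star a * b) = ip (rep_map a) (rep_map b) }.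

Definition rep_vna (R : realType) (A : algType R[i]) (star : A -> A)
    (phi : {scalar A}) (S : set A) (rho : representation star phi S) :
    set (rep_space rho -> rep_space rho) :=
  vna_generated [set P | exists a t, S a /\ P = rep_res rho a t].

Arguments rep_vna {R A star phi S} rho _.

(* Main.v *)
(* Both cyclic spaces [L_i], the closures of [alpha_i(A)], carry the Gram matrix
   [phi (a^* b)], so [alpha_1 b |-> alpha_2 b] extends to a partial isometry [V]
   with adjoint [W]. By the growth condition every [alpha_i b] is an analytic
   vector of [pi_i(a)], with a radius depending on [a] only, so (Nelson) the
   restriction of [pi_i(a)] to [alpha_i(A)] is essentially selfadjoint in [L_i];
   hence [V] intertwines [pi_1(a)] and [pi_2(a)], and therefore also their spectral
   projections. Since the states are faithful, [xi_2] is separating for [N_2] and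
   cyclic for its commutant, and [T] in [N_1] is sent to the unique [S] in [N_2]
   with [S xi_2 = V T xi_1]. The same construction with [V] and [W] exchanged is
   inverse to it, and both maps are positive, so suprema are preserved. *)

(* A spectral resolution is given only through the diagonal measures of [(x, E_t x)]. That [T]
   commutes with [E_t], and that second moments bound the norm of [T x], has to be extracted from
   quadratic forms. Exponentials, square roots and a functional calculus are replaced by iterated
   inequalities, in which geometric growth forces a quantity to vanish.

   The radius in the analytic estimate must not depend on the vector: a vector [z] in the closure of
   [alpha(A)] that solves the deficiency equation satisfies
   [(1 + r) |(alpha b, z)| <= |alpha b| |z|] for all [b] with one [r > 0], and letting [alpha b]
   tend to [z] gives [z = 0].

   A vector in the domain of [pi_1(a)] may lie outside [L_1], so essential selfadjointness inside
   [L_1] does not by itself say where [V] sends that domain. The density of both [(a - i) alpha(A)]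
   and [(a + i) alpha(A)] in [L_1] is what settles it. *)
Require Import Defs.
From HB Require Import structures.
From mathcomp Require Import all_boot all_order all_algebra.
From mathcomp Require Import complex ring lra.
From mathcomp Require Import all_classical all_reals all_analysis.
From mathcomp Require Import measurable_realfun.
Set Implicit Arguments.
Unset Strict Implicit.
Unset Printing Implicit Defensive.
Import Order.TTheory GRing.Theory Num.Theory.
Import numFieldNormedType.Exports.
Local Open Scope classical_set_scope.
Local Open Scope ring_scope.
Local Open Scope complex_scope.

(** * Real inner product *)

Section RealInnerProduct.
Variables (R : realType) (H : hilbert R).
Implicit Types (x y z : H) (r : R).

(** The norm of [H] has values in [R[i]]. These real-valued versions keep the estimates in [R],
    within reach of [lra] and [nra]; [ipE] recovers the complex inner product. *)
Definition rip x y : R := complex.Re (ip x y).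
Definition nr x : R := complex.Re `|x|.

Lemma nrE x : (nr x)%:C = `|x|.
Proof. by rewrite /nr RRe_real ?ger0_real. Qed.

Lemma nr_ge0 x : 0 <= nr x.
Proof. by rewrite -lecR nrE normr_ge0. Qed.

Lemma ipDr x y z : ip x (y + z) = ip x y + ip x z.
Proof. by rewrite -[y in LHS]scale1r ip_scalar mul1r. Qed.

Lemma ip0r x : ip x 0 = 0.
Proof. by apply: (addrI (ip x 0)); rewrite -ipDr !addr0. Qed.

Lemma ipZr x (c : R[i]) y : ip x (c *: y) = c * ip x y.
Proof. by rewrite -[c *: y]addr0 ip_scalar ip0r addr0. Qed.

Lemma ipNr x y : ip x (- y) = - ip x y.
Proof. by rewrite -scaleN1r ipZr mulN1r. Qed.

Lemma ipBr x y z : ip x (y - z) = ip x y - ip x z.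
Proof. by rewrite ipDr ipNr. Qed.

Lemma ipDl x y z : ip (x + y) z = ip x z + ip y z.
Proof. by rewrite ip_conj ipDr rmorphD/= -!ip_conj. Qed.

Lemma ipZl x (c : R[i]) y : ip (c *: x) y = c^* * ip x y.
Proof. by rewrite ip_conj ipZr rmorphM/= -ip_conj. Qed.

Lemma ipNl x y : ip (- x) y = - ip x y.
Proof. by rewrite ip_conj ipNr rmorphN/= -ip_conj. Qed.

Lemma ipBl x y z : ip (x - y) z = ip x z - ip y z.
Proof. by rewrite ipDl ipNl. Qed.

Lemma ip0l x : ip 0 x = 0.
Proof. by rewrite ip_conj ip0r rmorph0. Qed.

Lemma ripC x y : rip x y = rip y x.
Proof. by rewrite /rip ip_conj; case: (ip y x). Qed.

Lemma ripDr x y z : rip x (y + z) = rip x y + rip x z.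
Proof. by rewrite /rip ipDr raddfD. Qed.

Lemma ripDl x y z : rip (x + y) z = rip x z + rip y z.
Proof. by rewrite ripC ripDr !(ripC z). Qed.

Lemma ripNr x y : rip x (- y) = - rip x y.
Proof. by rewrite /rip ipNr raddfN. Qed.

Lemma ripNl x y : rip (- x) y = - rip x y.
Proof. by rewrite ripC ripNr ripC. Qed.

Lemma ripBr x y z : rip x (y - z) = rip x y - rip x z.
Proof. by rewrite ripDr ripNr. Qed.

Lemma ripBl x y z : rip (x - y) z = rip x z - rip y z.
Proof. by rewrite ripDl ripNl. Qed.

Lemma ripZr x r y : rip x (r%:C *: y) = r * rip x y.
Proof. by rewrite /rip ipZr; case: (ip x y) => a b /=; rewrite mul0r subr0. Qed.

Lemma ripZl x r y : rip (r%:C *: x) y = r * rip x y.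
Proof. by rewrite ripC ripZr ripC. Qed.

Lemma rip0r x : rip x 0 = 0.
Proof. by rewrite /rip ip0r. Qed.

Lemma rip0l x : rip 0 x = 0.
Proof. by rewrite /rip ip0l. Qed.

Definition ripE := (ripDr, ripDl, ripNr, ripNl, ripZr, ripZl, rip0r, rip0l).

Lemma ipE x y : ip x y = (rip x y)%:C - 'i * (rip x ('i *: y))%:C.
Proof.
rewrite /rip ipZr; case: (ip x y) => a b; simpc.
by rewrite /= ?mul0r ?mul1r ?sub0r ?add0r ?addr0 ?subr0 ?opprK.
Qed.

Lemma ripi x y : rip x ('i *: y) = - rip ('i *: x) y.
Proof.
rewrite /rip ipZl ipZr; case: (ip x y) => a b; simpc.
by rewrite /= ?mul0r ?mul1r ?sub0r ?add0r ?mulN1r ?opprK.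
Qed.

Lemma nr_sqr x : nr x ^+ 2 = rip x x.
Proof. by rewrite /rip -ip_norm -nrE -rmorphXn. Qed.

Lemma ip_self x : ip x x = (rip x x)%:C.
Proof. by rewrite -nr_sqr rmorphXn/= nrE ip_norm. Qed.

Lemma rip_ge0 x : 0 <= rip x x.
Proof. by rewrite -nr_sqr sqr_ge0. Qed.

Lemma nr0 : nr 0 = 0.
Proof. by rewrite /nr normr0. Qed.

Lemma nr_eq0 x : nr x = 0 -> x = 0.
Proof. by move=> h; apply/eqP; rewrite -normr_eq0 -nrE h. Qed.

Lemma rip_eq0 x : rip x x = 0 -> x = 0.
Proof. by rewrite -nr_sqr => /eqP; rewrite sqrf_eq0 => /eqP/nr_eq0. Qed.

Lemma nrD x y : nr (x + y) <= nr x + nr y.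
Proof. by rewrite -lecR rmorphD/= !nrE ler_normD. Qed.

Lemma nrN x : nr (- x) = nr x.
Proof. by rewrite /nr normrN. Qed.

Lemma nrB x y : nr (x - y) = nr (y - x).
Proof. by rewrite -nrN opprB. Qed.

Lemma nrZ (c : R[i]) x : nr (c *: x) = complex.Re `|c| * nr x.
Proof.
have := nrE (c *: x); rewrite normrZ -nrE.
have -> : `|c| = (complex.Re `|c|)%:C by rewrite RRe_real ?ger0_real.
by rewrite -rmorphM/= => -[].
Qed.

Lemma nrZr r x : nr (r%:C *: x) = `|r| * nr x.
Proof. by rewrite nrZ normc_def/= expr0n addr0 sqrtr_sqr. Qed.

Lemma nrZi x : nr ('i *: x) = nr x.
Proof. by rewrite nrZ normc_def/= expr0n add0r expr1n sqrtr1 mul1r. Qed.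

Lemma discr_le (a b c : R) :
  (forall t, 0 <= a + 2 * b * t + c * t ^+ 2) -> b ^+ 2 <= a * c.
Proof.
move=> h.
have a0 : 0 <= a by have := h 0; rewrite expr0n/= !mulr0 !addr0.
have c0 : 0 <= c.
  rewrite leNgt; apply/negP => c0.
  (* At this [t >= 1] one has [- c * t = 2 |b| + a + 1 - c], so for [c < 0] the quadratic would be
     at most [(c - 1) * t < 0]. *)
  have := h ((`|b| * 2 + a + 1) / - c + 1); set t := (_ + 1) => ht.
  have tc : - c * t = `|b| * 2 + a + 1 - c.
    by rewrite /t mulrDr mulrCA divff ?mulr1// oppr_eq0 lt_eqF.
  have bb : b <= `|b| := ler_norm b.
  have b0 : 0 <= `|b| := normr_ge0 b.
  have t1 : 1 <= t by rewrite lerDr divr_ge0//; lra.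
  have : c * t ^+ 2 = - (`|b| * 2 + a + 1 - c) * t by rewrite -tc; ring.
  move=> E; rewrite E in ht.
  have : 2 * b * t <= 2 * `|b| * t by rewrite ler_wpM2r ?ler_wpM2l//; lra.
  have : a * 1 <= a * t by rewrite ler_wpM2l.
  have : c * t < 0 by rewrite nmulr_rlt0//; lra.
  nra.
have [c00|cp] := eqVneq c 0.
  have [->|b0] := eqVneq b 0; first by rewrite expr0n mulr_ge0.
  (* With [c = 0] the value at this point is [-1]. *)
  have := h (- (a + 1) / (2 * b)).
  rewrite c00 mul0r addr0 mulrC divfK ?mulf_neq0//; lra.
have {}cp : 0 < c by rewrite lt0r cp.
have := h (- b / c).
have -> : a + 2 * b * (- b / c) + c * (- b / c) ^+ 2 = (a * c - b ^+ 2) / c.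
  by field; rewrite gt_eqF.
by rewrite pmulr_lge0 ?invr_gt0// subr_ge0.
Qed.

Lemma rip_cs_sqr x y : rip x y ^+ 2 <= rip x x * rip y y.
Proof.
apply: discr_le => t; have := rip_ge0 (x + t%:C *: y).
by rewrite !ripE (ripC y x); congr (_ <= _); ring.
Qed.

Lemma rip_cs x y : `|rip x y| <= nr x * nr y.
Proof.
rewrite -ler_sqr ?nnegrE ?mulr_ge0 ?nr_ge0// exprMn !nr_sqr.
by rewrite real_normK ?num_real// rip_cs_sqr.
Qed.

Lemma rip_le x y : rip x y <= nr x * nr y.
Proof. exact: le_trans (ler_norm _) (rip_cs _ _). Qed.

Lemma parallelogram x y :
  nr (x + y) ^+ 2 + nr (x - y) ^+ 2 = 2 * (nr x ^+ 2 + nr y ^+ 2).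
Proof. by rewrite !nr_sqr !ripE (ripC y x); ring. Qed.

Lemma rip_inj u v : (forall x, rip x u = rip x v) -> u = v.
Proof.
move=> h; apply/eqP; rewrite -subr_eq0; apply/eqP/rip_eq0.
by rewrite ripBr h subrr.
Qed.

Lemma nr_small x : (forall e, 0 < e -> nr x <= e) -> x = 0.
Proof.
move=> h; apply/nr_eq0/eqP; rewrite eq_le nr_ge0 andbT.
by apply/ler_addgt0Pr => e e0; rewrite add0r h.
Qed.

Lemma eq_of_close x y : (forall e, 0 < e -> nr (x - y) <= e) -> x = y.
Proof. by move=> h; apply/eqP; rewrite -subr_eq0; apply/eqP/nr_small. Qed.

Lemma complex_ltE (e : R[i]) : 0 < e -> e = (complex.Re e)%:C /\ 0 < complex.Re e.
Proof.
move=> e0; have h : e = (complex.Re e)%:C by rewrite RRe_real ?gtr0_real.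
by split=> //; rewrite -ltcR -h.
Qed.

Lemma nr_cvgP (T : Type) (F : set_system T) (FF : Filter F) (f : T -> H) x :
  f @ F --> x <-> forall e, 0 < e -> \forall t \near F, nr (x - f t) < e.
Proof.
split.
  move/cvgrPdist_lt => h e e0; have e0' : 0 < e%:C :> R[i] by rewrite ltcR.
  by have := h _ e0'; apply: filterS => t; rewrite -nrE ltcR.
move=> h; apply/cvgrPdist_lt => e /complex_ltE[-> e0].
by have := h _ e0; apply: filterS => t; rewrite -nrE ltcR.
Qed.

Lemma dense_nr (D : set H) : dense D <->
  forall x e, 0 < e -> exists2 d, D d & nr (x - d) < e.
Proof.
split=> [h x e e0|h].
  have e0' : 0 < e%:C :> R[i] by rewrite ltcR.
  have [||d []] := h (ball x e%:C).
  - by exists x; exact: ballxx.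
  - exact: ball_open.
  by rewrite -ball_normE /ball_/= -nrE ltcR => ? ?; exists d.
move=> U [x Ux] oU.
have /nbhs_ballP[e /= /complex_ltE[-> e0] hU] : nbhs x U by exact: open_nbhs_nbhs.
have [d Dd dx] := h x _ e0; exists d; split => //; apply: hU.
by rewrite -ball_normE /ball_/= -nrE ltcR.
Qed.

Lemma nr_complete (u : nat -> H) :
  (forall e, 0 < e -> exists N, forall m n, (N <= m)%N -> (N <= n)%N ->
     nr (u m - u n) < e) ->
  exists x, forall e, 0 < e -> exists N, forall n, (N <= n)%N -> nr (x - u n) < e.
Proof.
move=> h.
have : cauchy (u @ \oo).
  apply/cauchy_ballP => e /complex_ltE[-> e0].
  have [N hN] := h _ e0.
  near=> p.
  have [p1 p2] : [set p1 | exists2 m, (N <= m)%N & p1 = u m] p.1 /\ [set p1 | exists2 m, (N <= m)%N & p1 = u m] p.2.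
    near: p.
    exists ([set p1 | exists2 m, (N <= m)%N & p1 = u m],
      [set p1 | exists2 m, (N <= m)%N & p1 = u m]).
      by split; exists N => // m Nm; exists m.
    by case=> a b [].
  case: p1 => m Nm ->; case: p2 => n Nn ->.
  by rewrite -ball_normE /ball_/= -nrE ltcR hN.
move/cauchy_cvg => cu; exists (lim (u @ \oo)) => e e0.
have /nr_cvgP/(_ e e0)[N _ hN] := cu; exists N => n Nn; exact: hN.
Unshelve. all: by end_near. Qed.

End RealInnerProduct.

Definition cabs (R : realType) (c : R[i]) : R := complex.Re `|c|.

Lemma cabs_ge0 (R : realType) (c : R[i]) : 0 <= cabs c.
Proof. by have : (0 : R[i]) <= `|c| by []; rewrite lecE => /andP[]. Qed.

(** The [+ 1] covers [c = 0]; operator bounds [K] are handled below with [K + 1] for the same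
    reason. *)
Lemma nrZ_small (R : realType) (H : hilbert R) (c : R[i]) (x : H) (e : R) :
  nr x < e / (cabs c + 1) -> nr (c *: x) <= e.
Proof.
have k0 : 0 < cabs c + 1 by rewrite ltr_wpDl ?cabs_ge0.
rewrite ltr_pdivlMr// => h; rewrite nrZ -/(cabs c); apply: le_trans (ltW h).
by rewrite mulrC ler_wpM2l ?nr_ge0// lerDl.
Qed.

Lemma inv_nat_lt (R : realType) (e : R) : 0 < e ->
  exists N, forall n, (N <= n)%N -> n.+1%:R^-1 < e.
Proof.
by move=> e0; have [N _ hN] := near_infty_natSinv_lt (PosNum e0); exists N => n /hN.
Qed.

(** * Projections and extension of bounded operators *)

Section Projection.
Variables (R : realType) (H : hilbert R).
Implicit Types (x y z : H) (D : set H).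

Definition linspace D := D 0 /\ forall (c : R[i]) x y, D x -> D y -> D (c *: x + y).
(** Membership in the closure of [D]. The subspaces used below are not closed, so projections land
    in [limpt D]. *)
Definition limpt D x := forall e, 0 < e -> exists2 d, D d & nr (x - d) < e.

Lemma linspaceD D x y : linspace D -> D x -> D y -> D (x + y).
Proof. by move=> [_ h] Dx Dy; rewrite -[x]scale1r; exact: h. Qed.

Lemma linspaceZ D (c : R[i]) x : linspace D -> D x -> D (c *: x).
Proof. by move=> [D0 h] Dx; rewrite -[_ *: _]addr0; exact: h. Qed.

Lemma linspaceB D x y : linspace D -> D x -> D y -> D (x - y).
Proof. by move=> sD Dx Dy; rewrite -scaleN1r; apply: linspaceD => //; exact: linspaceZ. Qed.

Lemma limpt_sub D x : D x -> limpt D x.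
Proof. by move=> Dx e e0; exists x => //; rewrite subrr nr0. Qed.

Lemma rip_orth D x : linspace D -> (forall d, D d -> rip d x = 0) ->
  forall d, D d -> ip d x = 0.
Proof.
move=> sD h d Dd; rewrite ipE h// ripi h ?oppr0 ?mulr0 ?subr0//.
exact: linspaceZ.
Qed.

Lemma ip_limpt0 D x z : (forall d, D d -> ip d x = 0) -> limpt D z -> ip z x = 0.
Proof.
have step w : (forall d, D d -> ip d w = 0) -> limpt D z -> rip z w = 0.
  move=> h lz; apply/eqP; rewrite -normr_le0; apply/ler_addgt0Pr => e e0.
  have w0 : 0 < nr w + 1 by rewrite ltr_wpDl// nr_ge0.
  have [|d Dd dz] := lz (e / (nr w + 1)); first exact: divr_gt0.
  have -> : rip z w = rip (z - d) w.
    by rewrite ripBl {3}/rip h//= subr0.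
  rewrite add0r (le_trans (rip_cs _ _))//.
  rewrite (@le_trans _ _ (e / (nr w + 1) * (nr w + 1)))//; last first.
    by rewrite divfK// gt_eqF.
  by apply: ler_pM; rewrite ?nr_ge0 ?ltW// ltrDl.
move=> h lz; rewrite ipE !step ?mulr0 ?subr0//.
by move=> d Dd; rewrite ipZr h// mulr0.
Qed.

Lemma limpt_linspace D : linspace D -> linspace (limpt D).
Proof.
move=> sD; split; first by apply: limpt_sub; case: sD.
move=> c x y lx ly e e0.
have k0 : 0 < cabs c + 1 by rewrite ltr_wpDl ?cabs_ge0.
have [|u Du ux] := lx (e / 2 / (cabs c + 1)); first by rewrite !divr_gt0.
have [|v Dv vy] := ly (e / 2); first by rewrite divr_gt0.
exists (c *: u + v); first by case: sD => _; apply.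
rewrite opprD addrACA -scalerBr (le_lt_trans (nrD _ _))//.
by rewrite [e]splitr ler_ltD// nrZ_small.
Qed.

(** A minimizing sequence for the distance from [x] to [D] is Cauchy by the parallelogram law, and
    minimality of the distance gives orthogonality. *)
Lemma projection_theorem D x : linspace D ->
  exists2 p, limpt D p & forall d, D d -> ip d (x - p) = 0.
Proof.
move=> sD.
pose A := [set nr (x - d) | d in D]; pose dl := inf A.
have hA : has_inf A.
  split; first by exists (nr (x - 0)); exists 0 => //; case: sD.
  by exists 0 => _ [d _ <-]; exact: nr_ge0.
have dl_le d : D d -> dl <= nr (x - d).
  by move=> Dd; apply: ge_inf; [case: hA|exists d].
have dl0 : 0 <= dl by apply: lb_le_inf; [case: hA|move=> _ [d _ <-]; exact: nr_ge0].
have /choice[u hu] : forall n : nat, exists d, D d /\ nr (x - d) < dl + n.+1%:R^-1.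
  move=> n; have [|_ [d Dd <-] hd] := @inf_adherent R A n.+1%:R^-1 _ hA; last by exists d.
  by rewrite invr_gt0.
have [e e0|p hp] := @nr_complete R H u.
  (* If both distances are below [dl + k], the parallelogram law bounds the squared gap by
     [4 (dl + k)^2 - 4 dl^2 = 4 k (2 dl + k)], which is at most [e^2] for this [k <= 1]. *)
  pose k := Num.min 1 (e ^+ 2 / (4 * (2 * dl + 1))).
  have d1 : 0 < 4 * (2 * dl + 1) by lra.
  have k0 : 0 < k by rewrite lt_min ltr01 divr_gt0// exprn_gt0.
  have k1 : k <= 1 by rewrite ge_min lexx.
  have ke : k * (4 * (2 * dl + 1)) <= e ^+ 2.
    by rewrite -ler_pdivlMr// ge_min lexx orbT.
  have [N hN] := inv_nat_lt k0; exists N => m n Nm Nn.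
  have [Dm um] := hu m; have [Dn un] := hu n.
  have := parallelogram (x - u m) (x - u n).
  have -> : x - u m - (x - u n) = u n - u m by rewrite opprB addrC addrA subrK.
  have -> : x - u m + (x - u n) = 2%:R%:C *: (x - (2^-1)%:C *: (u m + u n)).
    rewrite scalerBr scalerA -rmorphM/= divff// scale1r rmorph_nat scaler_nat.
    by rewrite mulr2n addrACA -opprD.
  rewrite nrZr ger0_norm// exprMn => E.
  have /dl_le h1 : D ((2^-1)%:C *: (u m + u n)).
    by apply: linspaceZ => //; exact: linspaceD.
  have h2 : dl ^+ 2 <= nr (x - (2^-1)%:C *: (u m + u n)) ^+ 2 by rewrite ler_sqr ?nnegrE ?nr_ge0.
  have h3 : nr (x - u m) ^+ 2 < (dl + k) ^+ 2.
    by rewrite ltr_sqr ?nnegrE ?nr_ge0 ?addr_ge0 ?(ltW k0)// (lt_trans um)// ltrD2l hN.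
  have h4 : nr (x - u n) ^+ 2 < (dl + k) ^+ 2.
    by rewrite ltr_sqr ?nnegrE ?nr_ge0 ?addr_ge0 ?(ltW k0)// (lt_trans un)// ltrD2l hN.
  rewrite nrB -ltr_sqr ?nnegrE ?nr_ge0 ?ltW//.
  nra.
exists p => [e e0|].
  by have [N hN] := hp e e0; exists (u N); [case: (hu N)|exact: hN].
have hlow v : D v -> dl <= nr (x - p + v).
  move=> Dv; apply/ler_addgt0Pr => e e0.
  have [N hN] := hp e e0.
  have [Du _] := hu N.
  have := dl_le (u N - v) (linspaceB sD Du Dv).
  have -> : x - (u N - v) = x - p + v + (p - u N).
    by rewrite opprB [RHS]addrAC subrKA addrA addrAC.
  move/le_trans; apply; apply: le_trans (nrD _ _) _.
  by rewrite lerD2l ltW// hN.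
have hup : nr (x - p) <= dl.
  apply/ler_addgt0Pr => e e0.
  have e2 : 0 < e / 2 by rewrite divr_gt0.
  have [N hN] := hp _ e2; have [M hM] := inv_nat_lt e2.
  pose n := maxn N M; have [Dn un] := hu n.
  have -> : x - p = x - u n - (p - u n) by rewrite opprB addrA subrK.
  apply: le_trans (nrD _ _) _; rewrite nrN [e]splitr addrA lerD//; last first.
    by rewrite ltW// hN// leq_maxl.
  by rewrite (le_trans (ltW un))// lerD2l ltW// hM// leq_maxr.
apply: rip_orth => // d Dd; move: (x - p) hlow hup => w hlow hup.
(* The quadratic [|w + t d|^2 - |w|^2] is nonnegative and has constant term [0], so its linear
   coefficient vanishes. *)
have : rip d w ^+ 2 <= 0 * nr d ^+ 2.
  apply: discr_le => t.
  have := hlow (t%:C *: d) (linspaceZ _ sD Dd) => h.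
  have : dl ^+ 2 <= nr (w + t%:C *: d) ^+ 2 by rewrite ler_sqr ?nnegrE ?nr_ge0.
  have : nr w ^+ 2 <= dl ^+ 2 by rewrite ler_sqr ?nnegrE ?nr_ge0.
  rewrite !nr_sqr !ripE (ripC w d); nra.
rewrite mul0r => h; apply/eqP; rewrite -sqrf_eq0 eq_le h sqr_ge0//.
Qed.

End Projection.

Section Extension.
Variables (R : realType) (H H' : hilbert R).

(** [G] is a relation because its instances describe the argument by data that need not be unique.
    Linearity and the bound make it single-valued, and [P] in the proof is the closure of its
    graph. *)
Lemma bounded_extension (G : H -> H' -> Prop) (K : R) :
  0 <= K ->
  (forall (c : R[i]) u v u' v', G u v -> G u' v' -> G (c *: u + u') (c *: v + v')) ->
  (forall u v, G u v -> nr v <= K * nr u) ->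
  (forall x e, 0 < e -> exists u v, G u v /\ nr (x - u) < e) ->
  exists S : H -> H', [/\ linear S, forall x, nr (S x) <= K * nr x &
    forall u v, G u v -> S u = v].
Proof.
move=> K0 Glin Gbd Gdense.
pose P x y := forall e, 0 < e ->
  exists u v, [/\ G u v, nr (x - u) < e & nr (y - v) < e].
have GB u v u' v' : G u v -> G u' v' -> G (u - u') (v - v').
  by move=> h h'; rewrite addrC -scaleN1r [v - v']addrC -[- v']scaleN1r; exact: Glin.
have Pex x : exists y, P x y.
  have /choice[u] : forall n : nat, exists w : H * H', G w.1 w.2 /\ nr (x - w.1) < n.+1%:R^-1.
    move=> n; have [|u [v [h1 h2]]] := Gdense x n.+1%:R^-1; first by rewrite invr_gt0.
    by exists (u, v).
  move=> hu.
  have [e e0|y hy] := @nr_complete R H' (fun n => (u n).2).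
    have K1 : 0 < K + 1 by rewrite ltr_wpDl.
    have k0 : 0 < e / 2 / (K + 1) by rewrite !divr_gt0.
    have [N hN] := inv_nat_lt k0; exists N => m n Nm Nn.
    have [Gm um] := hu m; have [Gn un] := hu n.
    apply: le_lt_trans (Gbd _ _ (GB _ _ _ _ Gm Gn)) _.
    have -> : (u m).1 - (u n).1 = (x - (u n).1) - (x - (u m).1).
      by rewrite opprB [RHS]addrC addrA subrK.
    have h1 := lt_trans um (hN m Nm); have h2 := lt_trans un (hN n Nn).
    set a := x - (u n).1 in h2 *; set b := x - (u m).1 in h1 *.
    have ab : nr (a - b) < 2 * (e / 2 / (K + 1)).
      by rewrite (le_lt_trans (nrD _ _))// nrN mulr2n mulrDl mul1r ltrD.
    have : K * nr (a - b) <= (K + 1) * nr (a - b) by rewrite ler_wpM2r ?nr_ge0//; lra.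
    move/le_lt_trans; apply; rewrite mulrC -ltr_pdivlMr//.
    by have <- : 2 * (e / 2 / (K + 1)) = e / (K + 1) by field; rewrite gt_eqF.
  exists y => e e0; have [N hN] := hy e e0; have [M hM] := inv_nat_lt e0.
  pose n := maxn N M; have [Gn un] := hu n.
  exists (u n).1, (u n).2; split => //; last by rewrite hN// leq_maxl.
  by rewrite (lt_trans un)// hM// leq_maxr.
have Pbd x y : P x y -> nr y <= K * nr x.
  move=> h; apply/ler_addgt0Pr => e e0.
  have K1 : 0 < K + 1 by rewrite ltr_wpDl.
  have [|u [v [Guv ux vy]]] := h (e / (K + 1)); first by rewrite divr_gt0.
  have -> : y = (y - v) + v by rewrite subrK.
  apply: le_trans (nrD _ _) _; have := Gbd _ _ Guv.
  have : nr u <= nr x + e / (K + 1).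
    have -> : u = x - (x - u) by rewrite opprB addrC subrK.
    by rewrite (le_trans (nrD _ _))// nrN lerD2l ltW.
  move/(ler_wpM2l K0).
  have -> : K * (nr x + e / (K + 1)) = K * nr x + e - e / (K + 1).
    by field; rewrite gt_eqF.
  lra.
have Plin (c : R[i]) x y x' y' : P x y -> P x' y' -> P (c *: x + x') (c *: y + y').
  move=> h h' e e0.
  have k0 : 0 < cabs c + 1 by rewrite ltr_wpDl ?cabs_ge0.
  have [|u [v [Gu ux vy]]] := h (e / 2 / (cabs c + 1)); first by rewrite !divr_gt0.
  have [|u' [v' [Gu' ux' vy']]] := h' (e / 2); first by rewrite divr_gt0.
  exists (c *: u + u'), (c *: v + v'); split; first exact: Glin.
    rewrite opprD addrACA -scalerBr (le_lt_trans (nrD _ _))//.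
    by rewrite [e]splitr ler_ltD// nrZ_small.
  rewrite opprD addrACA -scalerBr (le_lt_trans (nrD _ _))//.
  by rewrite [e]splitr ler_ltD// nrZ_small.
have Puniq x y y' : P x y -> P x y' -> y = y'.
  move=> h h'; have := Plin (-1) _ _ _ _ h' h; rewrite !scaleN1r addNr => /Pbd.
  rewrite nr0 mulr0 => h0; apply/eqP; rewrite -subr_eq0 addrC; apply/eqP/nr_eq0/eqP.
  by rewrite eq_le h0 nr_ge0.
have [S hS] := choice Pex.
exists S; split.
- by move=> c x y; apply: (Puniq (c *: x + y)); [exact: hS|apply: Plin; exact: hS].
- by move=> x; apply: Pbd; exact: hS.
- move=> u v Guv; apply: (Puniq u); first exact: hS.
  by move=> e e0; exists u, v; rewrite !subrr !nr0.
Qed.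

End Extension.

(** * Adjoints and commutants *)

Section LinearMaps.
Variables (R : realType) (H H' : hilbert R) (T : H -> H').
Hypothesis linT : linear T.

Lemma linD x y : T (x + y) = T x + T y.
Proof. by have := linT 1 x y; rewrite !scale1r. Qed.
Lemma lin0 : T 0 = 0.
Proof. by apply: (addrI (T 0)); rewrite -linD !addr0. Qed.
Lemma linZ (c : R[i]) x : T (c *: x) = c *: T x.
Proof. by rewrite -[c *: x]addr0 linT lin0 addr0. Qed.
Lemma linN x : T (- x) = - T x.
Proof. by rewrite -scaleN1r linZ scaleN1r. Qed.
Lemma linB x y : T (x - y) = T x - T y.
Proof. by rewrite linD linN. Qed.

Definition bdd := exists2 K : R, 0 <= K & forall x, nr (T x) <= K * nr x.

Lemma continuous_bddP : continuous T <-> bdd.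
Proof.
pose L : {linear H -> H'} := HB.pack T (GRing.isLinear.Build _ _ _ _ T linT).
have Lb := @linear_bounded_continuous _ _ _ L.
split=> [/Lb/linear_boundedP/pinfty_ex_gt0[M /complex_ltE[-> M0] h]|[K K0 h]].
  by exists (complex.Re M) => [|x]; [exact: ltW|have := h x; rewrite -!nrE -rmorphM lecR].
apply/Lb/linear_boundedP; near=> r => x /=.
have Kr : K%:C <= r.
  by near: r; apply: nbhs_pinfty_ge; rewrite complex_real.
rewrite (@le_trans _ _ (K%:C * `|x|))//; last by rewrite ler_wpM2r.
by rewrite -!nrE -rmorphM lecR h.
Unshelve. all: by end_near. Qed.

End LinearMaps.

(** Only real parts are compared, which avoids conjugations; for linear [V] the complex identity
    follows in [adj_ip] by moving ['i] through [V]. *)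
Definition adj (R : realType) (H H' : hilbert R) (V : H -> H') (W : H' -> H) :=
  forall x y, rip x (V y) = rip (W x) y.

Section Adjoints.
Variables (R : realType) (H H' : hilbert R).
Implicit Types (V : H -> H') (W : H' -> H).

Lemma adjC V W : adj V W -> adj W V.
Proof. by move=> h x y; rewrite ripC -h ripC. Qed.

Lemma ip_eq0 (u : H) : ip u u = 0 -> u = 0.
Proof. by move=> h; apply: rip_eq0; rewrite /rip h. Qed.

Lemma ip_inj (u v : H) : (forall x, ip x u = ip x v) -> u = v.
Proof. by move=> h; apply: rip_inj => x; rewrite /rip h. Qed.

Lemma adj_ip V W : linear V -> adj V W -> forall x y, ip x (V y) = ip (W x) y.
Proof. by move=> lV a x y; rewrite !ipE -!(linZ lV) !a. Qed.

Lemma adj_linear V W : linear V -> adj V W -> linear W.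
Proof.
move=> lV a c x y; apply: ip_inj => z.
rewrite ip_conj -(adj_ip lV a) -ip_conj.
rewrite !ipDr !ipZr; congr (_ * _ + _).
  by rewrite [RHS]ip_conj -(adj_ip lV a) -ip_conj.
by rewrite [RHS]ip_conj -(adj_ip lV a) -ip_conj.
Qed.

Lemma adj_bdd V W K : adj V W -> 0 <= K -> (forall x, nr (V x) <= K * nr x) ->
  forall x, nr (W x) <= K * nr x.
Proof.
move=> a K0 h x.
have := nr_sqr (W x); rewrite -a => e.
have : nr (W x) ^+ 2 <= nr x * (K * nr (W x)).
  by rewrite e (le_trans (rip_le _ _))// ler_wpM2l ?nr_ge0.
have [->|w0] := eqVneq (nr (W x)) 0; first by rewrite mulr_ge0 ?nr_ge0.
have wp : 0 < nr (W x) by rewrite lt0r w0 nr_ge0.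
by rewrite expr2 mulrA ler_pM2r// mulrC.
Qed.

Lemma adj_unique V W W' : adj V W -> adj V W' -> W = W'.
Proof.
by move=> a a'; apply/funext => x; apply: rip_inj => y; rewrite !(ripC y) -a a'.
Qed.

(** For nonzero [f], the representing vector is a multiple of [u0 = x1 - p], where [f x1 = 1] and
    [p] is the projection of [x1] onto the closure of the kernel; boundedness of [f] puts [p] itself
    into the kernel. *)
Lemma riesz (f : H -> R[i]) (K : R) :
  (forall (c : R[i]) x y, f (c *: x + y) = c * f x + f y) ->
  0 <= K -> (forall x, cabs (f x) <= K * nr x) -> exists u, forall x, f x = ip u x.
Proof.
move=> flin K0 fK.
have f0 : f 0 = 0 by have /eqP := flin 1 0 0; rewrite scale1r mul1r addr0 -subr_eq0 opprD addNKr oppr_eq0 => /eqP.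
have fZ c x : f (c *: x) = c * f x by rewrite -[c *: x]addr0 flin f0 addr0.
have fB x y : f (x - y) = f x - f y by rewrite addrC -scaleN1r flin mulN1r addrC.
have [h|/existsNP[x0 /eqP x0N]] := pselect (forall x, f x = 0).
  by exists 0 => x; rewrite ip0l.
pose x1 := (f x0)^-1 *: x0; have fx1 : f x1 = 1 by rewrite fZ mulVf.
pose D := [set x | f x = 0].
have sD : linspace D.
  by split=> // c x y; rewrite /D/= flin => -> ->; rewrite mulr0 addr0.
have [p lp hp] := projection_theorem x1 sD.
have fp : f p = 0.
  apply/eqP; rewrite -normr_eq0.
  have -> : `|f p| = (cabs (f p))%:C by rewrite /cabs RRe_real// ger0_real.
  suff -> : cabs (f p) = 0 by [].
  apply/eqP; rewrite eq_le cabs_ge0 andbT; apply/ler_addgt0Pr => e e0; rewrite add0r.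
  have K1 : 0 < K + 1 by rewrite ltr_wpDl.
  have [|d Dd dp] := lp (e / (K + 1)); first by rewrite divr_gt0.
  have -> : f p = f (p - d) by rewrite fB [f d]Dd subr0.
  apply: le_trans (fK _) _.
  have : K * nr (p - d) <= (K + 1) * nr (p - d) by rewrite ler_wpM2r ?nr_ge0//; lra.
  by move/le_trans; apply; rewrite mulrC -ler_pdivlMr// ltW.
pose u0 := x1 - p; have fu0 : f u0 = 1 by rewrite fB fp fx1 subr0.
have u00 : ip u0 u0 != 0.
  apply/eqP => /ip_eq0 h.
  by move: fu0; rewrite h f0 => /eqP; rewrite eq_sym oner_eq0.
exists ((ip u0 u0)^-1 *: u0) => x.
have : ip (x - f x *: u0) u0 = 0.
  by apply: hp; rewrite /D/= fB fZ fu0 mulr1 subrr.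
rewrite ip_conj => /eqP; rewrite conjc_eq0 => /eqP.
rewrite ipBr ipZr => /eqP; rewrite subr_eq0 => /eqP h.
rewrite ipZl h ip_self fmorphV/= conj_Creal ?complex_real// -ip_self.
by rewrite mulrCA mulVf// mulr1.
Qed.

End Adjoints.

Lemma cabs_ip (R : realType) (H : hilbert R) (x y : H) : cabs (ip x y) <= nr x * nr y.
Proof.
have [->|z0] := eqVneq (ip x y) 0; first by rewrite /cabs normr0 mulr_ge0 ?nr_ge0.
have nE : `|ip x y| = (cabs (ip x y))%:C by rewrite /cabs RRe_real// ger0_real.
have c0 : cabs (ip x y) != 0.
  by apply: contraNneq z0 => c0; rewrite -normr_eq0 nE c0.
(* This phase makes the inner product real and nonnegative, which reduces the claim to the real
   Cauchy-Schwarz inequality. *)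
set c := (cabs (ip x y))%:C^-1 * (ip x y)^*.
have : rip x (c *: y) = cabs (ip x y).
  rewrite /rip ipZr -mulrA -normCKC nE.
  by rewrite expr2 mulKf// fmorph_eq0.
move=> <-; apply: le_trans (rip_le _ _) _; rewrite ler_wpM2l ?nr_ge0// nrZ.
have -> : `|c| = 1.
  rewrite normrM normfV norm_conjC nE ger0_norm ?mulVf ?fmorph_eq0//.
  by rewrite lecR cabs_ge0.
by rewrite mul1r.
Qed.

Lemma bdd_adj_exists (R : realType) (H H' : hilbert R) (V : H -> H') :
  linear V -> bdd V -> exists W, adj V W.
Proof.
move=> lV [K K0 VK].
have /choice[W hW] : forall y, exists u, forall x, ip y (V x) = ip u x.
  move=> y; apply: (@riesz _ _ _ (nr y * K)) => [c u v||x].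
  - by rewrite lV ip_scalar.
  - by rewrite mulr_ge0 ?nr_ge0.
  - by rewrite (le_trans (cabs_ip _ _))// -mulrA ler_wpM2l ?nr_ge0.
by exists W => y x; rewrite /rip hW.
Qed.

Lemma bernoulli_ineq (R : realType) (n : nat) (e : R) :
  0 <= e -> 1 + n%:R * e <= (1 + e) ^+ n.
Proof.
move=> e0; elim: n => [|n IH]; first by rewrite mul0r addr0.
rewrite exprS -natr1; apply: le_trans (ler_wpM2l _ IH); last by rewrite addr_ge0.
have : 0 <= n%:R * e ^+ 2 by rewrite mulr_ge0 ?sqr_ge0.
lra.
Qed.

Lemma geometric_bound (R : realType) (q a b : R) : 1 < q -> 0 <= a ->
  (forall k, q ^+ k * a <= b) -> a = 0.
Proof.
move=> q1 a0 h; apply/eqP; rewrite eq_le a0 andbT leNgt; apply/negP => ap.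
have q10 : 0 < q - 1 by rewrite subr_gt0.
have bern n : 1 + n%:R * (q - 1) <= q ^+ n.
  by have := bernoulli_ineq n (ltW q10); rewrite addrCA subrr addr0.
have bp : 0 <= b by have := h 0%N; rewrite expr0 mul1r; exact: le_trans.
have b0 : 0 <= b / (a * (q - 1)) by rewrite divr_ge0// mulr_ge0// ltW.
have := archi_boundP b0; set m := Num.bound _; rewrite ltr_pdivrMr ?mulr_gt0// => hm.
have := h m; rewrite leNgt => /negP; apply; apply: (lt_le_trans hm).
rewrite mulrCA mulrC ler_pM2r//; apply: le_trans (bern m).
by rewrite lerDr.
Qed.

(** * Commutants, separating and cyclic vectors, inequalities for positive operators *)

Section BoundedOperators.
Variables (R : realType) (H : hilbert R).
Implicit Types (T U : H -> H) (M X : set (H -> H)).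

Lemma bounded_operatorP T : bounded_operator T <-> linear T /\ bdd T.
Proof. by split=> -[lT h]; split => //; apply/(continuous_bddP lT). Qed.

Lemma adjointP T U : linear T -> adjoint T U <-> adj T U.
Proof.
by move=> lT; split=> [a x y|a]; [rewrite /rip a|exact: adj_ip].
Qed.

Lemma adj_exists T : bounded_operator T -> exists2 U, bounded_operator U & adj T U.
Proof.
move=> /bounded_operatorP[lT [K K0 TK]].
have [U a] := bdd_adj_exists lT (ex_intro2 _ _ K K0 TK).
exists U => //; apply/bounded_operatorP; split; first exact: adj_linear a.
by exists K => //; exact: adj_bdd a K0 TK.
Qed.

Lemma bounded_id : bounded_operator (id : H -> H).
Proof.
by apply/bounded_operatorP; split=> //; exists 1 => // x; rewrite mul1r.
Qed.

Lemma boundedD T U : bounded_operator T -> bounded_operator U ->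
  bounded_operator (fun x => T x + U x).
Proof.
move=> /bounded_operatorP[lT [K K0 TK]] /bounded_operatorP[lU [L L0 UL]].
apply/bounded_operatorP; split.
  by move=> c x y; rewrite lT lU scalerDr addrACA.
exists (K + L); first exact: addr_ge0.
by move=> x; rewrite (le_trans (nrD _ _))// mulrDl lerD.
Qed.

Lemma boundedZ (c : R[i]) T : bounded_operator T -> bounded_operator (fun x => c *: T x).
Proof.
move=> /bounded_operatorP[lT [K K0 TK]].
apply/bounded_operatorP; split.
  by move=> a x y; rewrite lT scalerDr !scalerA mulrC.
exists (cabs c * K); first by rewrite mulr_ge0 ?cabs_ge0.
by move=> x; rewrite nrZ -mulrA ler_wpM2l ?cabs_ge0.
Qed.

Lemma bounded_comp T U : bounded_operator T -> bounded_operator U ->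
  bounded_operator (T \o U).
Proof.
move=> /bounded_operatorP[lT [K K0 TK]] /bounded_operatorP[lU [L L0 UL]].
apply/bounded_operatorP; split.
  by move=> c x y /=; rewrite lU lT.
exists (K * L); first exact: mulr_ge0.
by move=> x /=; rewrite (le_trans (TK _))// -mulrA ler_wpM2l.
Qed.

Lemma comm_app T U : T \o U = U \o T -> forall x, T (U x) = U (T x).
Proof. by move=> h x; have := congr1 (fun f => f x) h. Qed.

Lemma commutant_id M : M `<=` @bounded_operator R H -> commutant M id.
Proof. by move=> Mb; split; first exact: bounded_id. Qed.

Lemma commutantD M T U : M `<=` @bounded_operator R H -> commutant M T -> commutant M U ->
  commutant M (fun x => T x + U x).
Proof.
move=> Mb [bT hT] [bU hU]; split; first exact: boundedD.
move=> V MV; apply/funext => x /=; have [lV _] := Mb _ MV.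
by rewrite (linD lV) (comm_app (hT _ MV)) (comm_app (hU _ MV)).
Qed.

Lemma commutantZ M (c : R[i]) T : M `<=` @bounded_operator R H -> commutant M T ->
  commutant M (fun x => c *: T x).
Proof.
move=> Mb [bT hT]; split; first exact: boundedZ.
move=> V MV; apply/funext => x /=; have [lV _] := Mb _ MV.
by rewrite (linZ lV) (comm_app (hT _ MV)).
Qed.

Lemma commutant_comp M T U : commutant M T -> commutant M U -> commutant M (T \o U).
Proof.
move=> [bT hT] [bU hU]; split; first exact: bounded_comp.
by move=> V MV; apply/funext => x /=; rewrite (comm_app (hU _ MV)) (comm_app (hT _ MV)).
Qed.

Lemma commutant_bounded M : commutant M `<=` @bounded_operator R H.
Proof. by move=> T []. Qed.

Lemma commutant_adj M T U : (forall V, M V -> exists2 V', M V' & adj V V') ->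
  commutant M T -> adj T U -> commutant M U.
Proof.
move=> Ma [bT hT] a; split.
  by have [U' bU' a'] := adj_exists bT; rewrite (adj_unique a a').
move=> V MV; have [V' MV' aV] := Ma _ MV.
apply/funext => x /=; apply: rip_inj => y.
by rewrite (adjC a) !aV (adjC a) (comm_app (hT _ MV')).
Qed.

Lemma commutantS M M' : M `<=` M' -> commutant M' `<=` commutant M.
Proof. by move=> MM T [bT hT]; split=> // U /MM; exact: hT. Qed.

Lemma sub_bicommutant M : M `<=` @bounded_operator R H -> M `<=` commutant (commutant M).
Proof. by move=> Mb T MT; split; [exact: Mb|move=> U [_ hU]; rewrite hU]. Qed.

Section SelfAdjointFamily.
Variable X : set (H -> H).
Hypothesis Xb : X `<=` @bounded_operator R H.
Hypothesis Xsa : forall T, X T -> adj T T.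

Lemma commutant_has_adj T : commutant X T -> exists2 U, commutant X U & adj T U.
Proof.
move=> cT; have [U _ a] := adj_exists (commutant_bounded cT).
by exists U => //; apply: commutant_adj cT a => V XV; exists V => //; exact: Xsa.
Qed.

Lemma bicommutant_adj T U : commutant (commutant X) T -> adj T U ->
  commutant (commutant X) U.
Proof. by apply: commutant_adj; exact: commutant_has_adj. Qed.

Lemma bicommutant_has_adj T : commutant (commutant X) T ->
  exists2 U, commutant (commutant X) U & adj T U.
Proof.
move=> cT; have [U _ a] := adj_exists (commutant_bounded cT).
by exists U => //; exact: bicommutant_adj a.
Qed.

Lemma bicommutant_vna : von_neumann_algebra (commutant (commutant X)).
Proof.
have cb := @commutant_bounded X.
split.
- exact: commutant_bounded.
- exact: commutant_id.
- by move=> T U; exact: commutantD.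
- by move=> c T; exact: commutantZ.
- by move=> T U; exact: commutant_comp.
- move=> T cT; have [U cU a] := bicommutant_has_adj cT; exists U => //.
  by apply/adjointP => //; case: (commutant_bounded cT).
- apply/seteqP; split; last exact/sub_bicommutant/commutant_bounded.
  exact/commutantS/sub_bicommutant.
Qed.

(** Formal, since [von_neumann_algebra] contains the bicommutant identity: the bicommutant of [X] is
    such an algebra, and any other [M] containing [X] contains it because [M] equals its own
    bicommutant. *)
Lemma vna_generatedE : vna_generated X = commutant (commutant X).
Proof.
apply/seteqP; split=> [T h|T cT M vM XM].
  by apply: h; [exact: bicommutant_vna|exact: sub_bicommutant].
rewrite -(vna_bicommutant vM); have := cT; apply/commutantS/commutantS; exact: XM.
Qed.

Variable xi : H.
Hypothesis fth : faithful (vector_state xi) (vna_generated X).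
Let N := commutant (commutant X).

Lemma faithful_separating T U : N T -> N U -> T xi = U xi -> T = U.
Proof.
move=> NT NU e; have cb := @commutant_bounded X.
pose S := fun x => T x + (-1) *: U x.
have NS : N S by apply: commutantD => //; exact: commutantZ.
have [S' NS' a] := bicommutant_has_adj NS.
have [lS _] := commutant_bounded NS; have [lS' _] := commutant_bounded NS'.
have S0 : S = fun=> 0.
  have := fth; rewrite vna_generatedE => /(_ S S' NS NS'); apply.
    exact/adjointP.
  rewrite /vector_state/= /S e scaleN1r subrr (lin0 lS') ip0r//.
apply/funext => x; have := congr1 (fun f => f x) S0; rewrite /S scaleN1r => /eqP.
by rewrite subr_eq0 => /eqP.
Qed.

(** The projection [q] onto the closure of [{Y xi}], with [Y] in the commutant, belongs to the
    bicommutant and fixes [xi]; since [xi] is separating, [q = id]. *)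
Lemma faithful_cyclic x e : 0 < e -> exists2 Y, commutant X Y & nr (x - Y xi) < e.
Proof.
pose D := [set z | exists2 Y, commutant X Y & z = Y xi].
have sD : linspace D.
  split.
    exists (fun x => 0%:C *: x); last by rewrite scale0r.
    by apply: commutantZ => //; exact: commutant_id.
  move=> c u v [Y cY ->] [Z cZ ->]; exists (fun x => c *: Y x + Z x) => //.
  by apply: commutantD => //; exact: commutantZ.
have /choice[q hq] : forall z, exists p, limpt D p /\ forall d, D d -> ip d (z - p) = 0.
  by move=> z; have [p] := projection_theorem z sD; exists p.
have quniq z p : limpt D p -> (forall d, D d -> ip d (z - p) = 0) -> q z = p.
  move=> lp op; have [lq oq] := hq z.
  have lqp : limpt D (q z - p) by apply: (linspaceB (limpt_linspace sD)).
  have : ip (q z - p) (q z - p) = 0.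
    have /(ip_limpt0) := lqp; apply => d Dd.
    have -> : q z - p = (z - p) - (z - q z) by rewrite opprB [RHS]addrC addrA subrK.
    by rewrite ipBr oq// op// subrr.
  by move/ip_eq0/eqP; rewrite subr_eq0 => /eqP.
have linq : linear q.
  move=> c u v; have [lu ou] := hq u; have [lv ov] := hq v; apply: quniq.
    by apply: (limpt_linspace sD).2.
  by move=> d Dd; rewrite opprD addrACA -scalerBr ipDr ipZr ou// ov// mulr0 addr0.
have adjq : adj q q.
  move=> u v; have [lu ou] := hq u; have [lv ov] := hq v.
  transitivity (rip (q u) (q v)); apply/eqP.
    by rewrite -subr_eq0 -ripBl ripC /rip (ip_limpt0 ou lv).
  by rewrite eq_sym -subr_eq0 -ripBr /rip (ip_limpt0 ov lu).
have qb : forall z, nr (q z) <= 1 * nr z.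
  move=> z; have [lz oz] := hq z; rewrite mul1r.
  have [->|w0] := eqVneq (nr (q z)) 0; first by rewrite nr_ge0.
  have wp : 0 < nr (q z) by rewrite lt0r w0 nr_ge0.
  rewrite -(ler_pM2l wp) -expr2 nr_sqr.
  have -> : rip (q z) (q z) = rip (q z) z.
    by apply/eqP; rewrite eq_sym -subr_eq0 -ripBr /rip (ip_limpt0 oz lz).
  exact: rip_le.
have bq : bounded_operator q by apply/bounded_operatorP; split=> //; exists 1.
(* [Y] and its adjoint preserve [D], so [Y (q z)] has the two properties that characterize
   [q (Y z)]. *)
have Nq : N q.
  split=> // Y cY; apply/funext => z /=.
  have [Y' cY' a] := commutant_has_adj cY.
  have [lY [K K0 YK]] := (bounded_operatorP _).1 (commutant_bounded cY).
  have [lz oz] := hq z; apply: quniq.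
    move=> d d0; have K1 : 0 < K + 1 by rewrite ltr_wpDl.
    have [|_ [Z cZ ->] hZ] := lz (d / (K + 1)); first by rewrite divr_gt0.
    exists (Y (Z xi)); first by exists (Y \o Z) => //; exact: commutant_comp.
    rewrite -(linB lY) (le_lt_trans (YK _))//.
    have : K * nr (q z - Z xi) <= (K + 1) * nr (q z - Z xi).
      by rewrite ler_wpM2r ?nr_ge0//; lra.
    by move/le_lt_trans; apply; rewrite mulrC -ltr_pdivlMr.
  move=> _ [Z cZ ->]; rewrite -(linB lY) (adj_ip lY a); apply: oz.
  by exists (Y' \o Z) => //; exact: commutant_comp.
have qxi : q xi = xi.
  apply: quniq; last by move=> d _; rewrite subrr ip0r.
  by apply: limpt_sub; exists id => //; exact: commutant_id.
have q1 : q = id.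
  apply: faithful_separating => //; apply: commutant_id; exact: commutant_bounded.
move=> e0; have [] := hq x; rewrite q1 => + _ => /(_ e e0)[_ [Y cY ->] h].
by exists Y.
Qed.

End SelfAdjointFamily.

(* Iterating Cauchy-Schwarz for the form [(u, A v)] along the powers of [B] gives
   [(x, A B x) ^ (2 ^ k) <= (x, A x) ^ (2 ^ k - 1) * (x, A B ^ (2 ^ k) x)], which
   avoids square roots of operators. *)
Lemma reid_inequality (A B : H -> H) (c K : R) (x : H) :
  linear A -> adj A A -> (forall u, 0 <= rip u (A u)) ->
  adj B B -> (forall u, A (B u) = B (A u)) ->
  0 <= c -> (forall u, nr (B u) <= c * nr u) -> 0 <= K -> (forall u, nr (A u) <= K * nr u) ->
  rip x (A (B x)) <= c * rip x (A x).
Proof.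
move=> lA aA A0 aB AB c0 Bc K0 AK.
pose C n := rip x (A (iter n B x)).
have ABn n u : A (iter n B u) = iter n B (A u).
  by elim: n => //= n <-; rewrite AB.
have aBn n : adj (iter n B) (iter n B).
  by elim: n => // n IH u v; rewrite iterSr IH /= aB.
have C2 n : C n ^+ 2 <= C 0%N * C (n + n)%N.
  have -> : C (n + n)%N = rip (iter n B x) (A (iter n B x)).
    by rewrite /C iterD ABn aBn.
  apply: discr_le => t; have := A0 (x + t%:C *: iter n B x).
  rewrite (linD lA) (linZ lA) !ripE (aA (iter n B x)) (ripC (A _) x) /C.
  by congr (_ <= _) => /=; ring.
have CK n : C n <= K * c ^+ n * nr x ^+ 2.
  have Bn : nr (iter n B x) <= c ^+ n * nr x.
    elim: n => [|n IH] /=; first by rewrite mul1r.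
    by rewrite (le_trans (Bc _))// exprS -mulrA ler_wpM2l.
  apply: le_trans (rip_le _ _) _; rewrite mulrC expr2 mulrA ler_wpM2r ?nr_ge0//.
  by rewrite (le_trans (AK _))// -mulrA ler_wpM2l.
rewrite -[rip x (A (B x))]/(C 1%N) -[rip x (A x)]/(C 0%N) leNgt; apply/negP => lt1.
have C00 : 0 <= C 0%N by exact: A0.
have [c00|cn0] := eqVneq c 0.
  move: lt1; rewrite c00 mul0r.
  by have := CK 1%N; rewrite c00 expr1 mulr0 mul0r => h /(le_lt_trans h); rewrite ltxx.
have {cn0}cp : 0 < c by rewrite lt0r cn0.
have C10 : 0 < C 1%N by rewrite (le_lt_trans _ lt1)// mulr_ge0.
have C0p : 0 < C 0%N.
  rewrite lt0r C00 andbT; apply/eqP => e; have := C2 1%N; rewrite e mul0r.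
  by rewrite leNgt exprn_gt0.
have pow k : C 1%N ^+ (2 ^ k) * C 0%N <= C 0%N ^+ (2 ^ k) * C (2 ^ k)%N.
  elim: k => [|k IH]; first by rewrite expn0 !expr1 mulrC.
  rewrite expnS mul2n -addnn !exprD.
  have h : (C 1%N ^+ (2 ^ k) * C 0%N) ^+ 2 <= (C 0%N ^+ (2 ^ k) * C (2 ^ k)%N) ^+ 2.
    by rewrite ler_sqr ?nnegrE// ?(le_trans _ IH)// mulr_ge0 ?exprn_ge0// ltW.
  have h5 := ler_wpM2l (sqr_ge0 (C 0%N ^+ (2 ^ k))) (C2 (2 ^ k)%N).
  rewrite -(ler_pM2r C0p).
  move: (C 1%N ^+ _) (C 0%N ^+ _) (C (2 ^ k)%N) (C (_ + _)%N) h h5 => u v w z; lra.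
pose q := C 1%N / (c * C 0%N).
have q1 : 1 < q by rewrite ltr_pdivlMr ?mulr_gt0// mul1r.
have bound k : q ^+ (2 ^ k) * C 0%N <= K * nr x ^+ 2.
  rewrite /q exprMn exprVn exprMn mulrAC ler_pdivrMr ?mulr_gt0 ?exprn_gt0//.
  apply: le_trans (pow k) _.
  have := ler_wpM2l (exprn_ge0 (2 ^ k) C00) (CK (2 ^ k)%N).
  move: (C 0%N ^+ _) (C (2 ^ k)%N) (c ^+ _) => u v w; lra.
have C0e : C 0%N = 0.
  apply: (geometric_bound q1 C00 (b := K * nr x ^+ 2)) => k; apply: le_trans (bound k).
  by rewrite ler_wpM2r// ler_eXn2l// ltnW// ltn_expl.
by move: C0p; rewrite C0e ltxx.
Qed.

(* Cauchy-Schwarz for the positive form [u, v |-> (u, B v)], with [y = B x] and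
   [z = B y]. *)
Lemma positive_form_norm (x y z : H) (c : R) :
  (forall t : R, 0 <= rip (x + t%:C *: y) (y + t%:C *: z)) ->
  rip x z = rip y y -> 0 <= c -> rip y z <= c * rip y y -> rip y y <= c * rip x y.
Proof.
move=> h xz c0 yz.
have xy0 : 0 <= rip x y by have := h 0; rewrite !scale0r !addr0.
have d : rip y y ^+ 2 <= rip x y * rip y z.
  by apply: discr_le => t; have := h t; rewrite !ripE xz; congr (_ <= _); ring.
have [->|y0] := eqVneq (rip y y) 0; first exact: mulr_ge0.
have yp : 0 < rip y y by rewrite lt0r y0 rip_ge0.
rewrite -(ler_pM2r yp) -expr2 (le_trans d)// mulrAC mulrC.
by rewrite ler_wpM2r.
Qed.

End BoundedOperators.

(** * Intertwined von Neumann algebras *)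

Section Density.
Variables (R : realType) (H H' : hilbert R).

Lemma eq_on_limpt (f g : H -> H') (D : set H) x :
  linear f -> linear g -> bdd f -> bdd g -> (forall d, D d -> f d = g d) ->
  limpt D x -> f x = g x.
Proof.
move=> lf lg [K K0 fK] [L L0 gL] fg lx; apply: eq_of_close => e e0.
have K1 : 0 < K + L + 1 by rewrite ltr_wpDl// addr_ge0.
have [|d Dd dx] := lx (e / (K + L + 1)); first by rewrite divr_gt0.
have -> : f x - g x = f (x - d) - g (x - d).
  by rewrite (linB lf) (linB lg) (fg d)// opprB addrA subrK.
apply: le_trans (nrD _ _) _; rewrite nrN.
have := fK (x - d); have := gL (x - d); have := nr_ge0 (x - d).
move: dx; rewrite ltr_pdivlMr//; nra.
Qed.

End Density.

Section PositiveOperators.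
Variables (R : realType) (H : hilbert R).
Implicit Types (T : H -> H).

(** The diagonal values are real; polarizing their imaginary part at [x] and ['i *: y] gives
    symmetry. *)
Lemma positive_adj T : linear T -> (forall x, 0 <= ip x (T x)) -> adj T T.
Proof.
move=> lT T0.
have im0 x : complex.Im (ip x (T x)) = 0 by have := T0 x; rewrite lecE => /andP[/eqP].
have imD x y : complex.Im (ip x (T y)) + complex.Im (ip y (T x)) = 0.
  by have := im0 (x + y); rewrite (linD lT) !ipDl !ipDr !raddfD/= !im0 add0r addr0.
move=> x y; have := imD x ('i *: y).
rewrite (linZ lT) ipZr ipZl /rip [ip (T x) y]ip_conj.
case: (ip x (T y)) (ip y (T x)) => a b [c d]; simpc => /=.
by rewrite ?mul0r ?mul1r ?add0r ?addr0 ?mulN1r => /eqP; rewrite subr_eq0 => /eqP.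
Qed.

Lemma adj_positive T : linear T -> adj T T -> (forall x, 0 <= rip x (T x)) ->
  forall x, 0 <= ip x (T x).
Proof.
move=> lT aT T0 x; have h : rip x (T ('i *: x)) = - rip x (T ('i *: x)).
  by rewrite {1}(linZ lT) ripi ripC -aT ripC -aT ripC.
have {}h : rip x (T ('i *: x)) = 0 by lra.
by rewrite ipE -(linZ lT) h mulr0 subr0 lecR.
Qed.

End PositiveOperators.

(** [it_isom] makes [V] a partial isometry; its initial and final spaces may be proper. Partners are
    required for both families so that the roles of [V] and [W] can be exchanged, as in
    [intertwiner_sym]. *)
Record intertwiner (R : realType) (H1 H2 : hilbert R)
    (X1 : set (H1 -> H1)) (xi1 : H1) (X2 : set (H2 -> H2)) (xi2 : H2)
    (V : H1 -> H2) (W : H2 -> H1) : Prop := {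
  it_lin : linear V;
  it_bdd : bdd V;
  it_adj : adj V W;
  it_isom : forall x, V (W (V x)) = V x;
  it_vec1 : V xi1 = xi2;
  it_vec2 : W xi2 = xi1;
  it_fam1 : forall T1, X1 T1 -> exists2 T2, X2 T2 & forall x, V (T1 x) = T2 (V x);
  it_fam2 : forall T2, X2 T2 -> exists2 T1, X1 T1 & forall x, V (T1 x) = T2 (V x) }.

Section Intertwine.
Variables (R : realType) (H1 H2 : hilbert R).
Variables (X1 : set (H1 -> H1)) (xi1 : H1) (X2 : set (H2 -> H2)) (xi2 : H2).
Variables (V : H1 -> H2) (W : H2 -> H1).
Hypothesis X1sa : forall T, X1 T -> adj T T.
Hypothesis X2b : X2 `<=` @bounded_operator R H2.
Hypothesis X2sa : forall T, X2 T -> adj T T.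
Hypothesis itV : intertwiner X1 xi1 X2 xi2 V W.
Let N1 := commutant (commutant X1).
Let N2 := commutant (commutant X2).

Let lV : linear V := it_lin itV.
Let aV : adj V W := it_adj itV.
Let lW : linear W := adj_linear lV aV.

Lemma intertwiner_adj T1 T2 : adj T1 T1 -> adj T2 T2 ->
  (forall x, V (T1 x) = T2 (V x)) -> forall y, W (T2 y) = T1 (W y).
Proof.
move=> a1 a2 h y; apply: rip_inj => x.
by rewrite (adjC aV) a2 -h -(adjC aV) a1.
Qed.

Lemma intertwiner_sym : intertwiner X2 xi2 X1 xi1 W V.
Proof.
case: itV => _ [K K0 VK] _ VWV e1 e2 f1 f2; split=> //.
- by exists K => //; exact: adj_bdd aV K0 VK.
- exact: adjC.
- by move=> y; apply: rip_inj => x; rewrite !(adjC aV) aV (adjC aV) VWV.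
- move=> T2 XT2; have [T1 XT1 h] := f2 _ XT2; exists T1 => //.
  by apply: intertwiner_adj => //; [exact: X1sa|exact: X2sa].
- move=> T1 XT1; have [T2 XT2 h] := f1 _ XT1; exists T2 => //.
  by apply: intertwiner_adj => //; [exact: X1sa|exact: X2sa].
Qed.

(** Both [V] and, by taking adjoints, [W] intertwine the two families. Compression is not
    multiplicative, but it transfers elements of the commutant, and at [Y = id] it yields the
    initial projection. *)
Lemma compress_commutant Y : commutant X2 Y -> commutant X1 (W \o Y \o V).
Proof.
move=> cY; have [lY [L L0 YL]] := (bounded_operatorP _).1 (commutant_bounded cY).
have [K K0 VK] := it_bdd itV; have WK := adj_bdd aV K0 VK.
split.
  apply/bounded_operatorP; split; first by move=> c x y /=; rewrite lV lY lW.
  exists (K * (L * K)); first by rewrite !mulr_ge0.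
  move=> x /=; apply: le_trans (WK _) _; rewrite -mulrA ler_wpM2l//.
  by apply: le_trans (YL _) _; rewrite -mulrA ler_wpM2l.
move=> T1 XT1; have [T2 XT2 h] := it_fam1 itV XT1.
apply/funext => x /=; rewrite h (comm_app (cY.2 _ XT2)).
by apply: intertwiner_adj; [exact: X1sa|exact: X2sa|].
Qed.

Lemma range_commutant : commutant X2 (V \o W).
Proof.
have [K K0 VK] := it_bdd itV; have WK := adj_bdd aV K0 VK.
split.
  apply/bounded_operatorP; split; first by move=> c x y /=; rewrite lW lV.
  exists (K * K); first exact: mulr_ge0.
  by move=> x /=; apply: le_trans (VK _) _; rewrite -mulrA ler_wpM2l.
move=> T2 XT2; have [T1 XT1 h] := it_fam2 itV XT2; apply/funext => x /=.
by rewrite (@intertwiner_adj T1 T2) ?h//; [exact: X1sa|exact: X2sa].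
Qed.

Lemma source_commutant : commutant X1 (W \o V).
Proof. exact: compress_commutant (commutant_id X2b). Qed.

Hypothesis fth2 : faithful (vector_state xi2) (vna_generated X2).

(** The graph of the future isomorphism. As [xi2] is separating, an algebraic identity between
    elements of [N2] has to be checked at [xi2] only. *)
Definition corresponds (T : H1 -> H1) (S : H2 -> H2) :=
  [/\ N1 T, N2 S & S xi2 = V (T xi1)].

Lemma corresponds_unique T S S' : corresponds T S -> corresponds T S' -> S = S'.
Proof.
move=> [_ NS e] [_ NS' e'].
by apply: (faithful_separating X2b X2sa fth2) => //; rewrite e e'.
Qed.

(* [Y xi2 |-> Y (V (T xi1))], for [Y] in the commutant of [X2], is bounded because
   the compression [W Y^* Y V] commutes with [T^* T]. *)
Lemma corresponds_exists T : N1 T -> exists S, corresponds T S.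
Proof.
move=> NT; have [lT [K K0 TK]] := (bounded_operatorP _).1 (commutant_bounded NT).
have [T' NT' aT] := bicommutant_has_adj X1sa NT.
have [lT' _] := commutant_bounded NT'.
pose G u v := exists Y, [/\ commutant X2 Y, u = Y xi2 & v = Y (V (T xi1))].
have Glin (c : R[i]) u v u' v' : G u v -> G u' v' -> G (c *: u + u') (c *: v + v').
  move=> [Y [cY -> ->]] [Z [cZ -> ->]]; exists (fun x => c *: Y x + Z x); split => //.
  by apply: commutantD => //; exact: commutantZ.
have Gb u v : G u v -> nr v <= K * nr u.
  move=> [Y [cY -> ->]]; have [Y' cY' aY] := commutant_has_adj X2sa cY.
  have [lY [L L0 YL]] := (bounded_operatorP _).1 (commutant_bounded cY).
  have cM := compress_commutant (commutant_comp cY' cY).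
  set M := W \o (Y' \o Y) \o V in cM.
  have [lM [J J0 MJ]] := (bounded_operatorP _).1 (commutant_bounded cM).
  have ME x y : rip x (M y) = rip (Y (V x)) (Y (V y)).
    by rewrite /M/= (adjC aV) (adjC aY).
  have aM : adj M M by move=> x y; rewrite ME [RHS]ripC ME ripC.
  have TM y : T (M y) = M (T y) by apply: comm_app; exact: NT.2.
  have T'M y : T' (M y) = M (T' y) by apply: comm_app; exact: NT'.2.
  (* Since [M] commutes with [T] and [T'], [(xi1, M T' T xi1)] is the squared norm of
     [Y (V (T xi1))], and [(xi1, M xi1)] that of [Y xi2]. *)
  have := @reid_inequality R H1 M (T' \o T) (K ^+ 2) J xi1 lM aM => kr.
  rewrite -ler_sqr ?nnegrE ?mulr_ge0 ?nr_ge0// exprMn !nr_sqr -ME.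
  rewrite -(it_vec1 itV) -(ME xi1) -(adjC aT) T'M; apply: kr => //=.
  - by move=> u'; rewrite ME rip_ge0.
  - by move=> x y /=; rewrite (adjC aT) -aT.
  - by move=> x; rewrite TM T'M.
  - exact: sqr_ge0.
  - move=> x; rewrite expr2 -mulrA (le_trans (adj_bdd aT K0 TK _))//.
    by rewrite ler_wpM2l.
have Gd x e : 0 < e -> exists u v, G u v /\ nr (x - u) < e.
  move=> e0; have [Y cY h] := faithful_cyclic X2b X2sa fth2 x e0.
  by exists (Y xi2), (Y (V (T xi1))); split => //; exists Y.
have [S [lS SK SG]] := bounded_extension K0 Glin Gb Gd.
have SY Y : commutant X2 Y -> S (Y xi2) = Y (V (T xi1)) by move=> cY; apply: SG; exists Y.
exists S; split => //; last by rewrite (SY id)//; exact: commutant_id.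
split; first by apply/bounded_operatorP; split => //; exists K.
move=> Y cY; apply/funext => x /=.
have [lY [L L0 YL]] := (bounded_operatorP _).1 (commutant_bounded cY).
apply: (@eq_on_limpt _ _ _ (S \o Y) (Y \o S) [set z | exists2 Z, commutant X2 Z & z = Z xi2]).
- by move=> c u v /=; rewrite lY lS.
- by move=> c u v /=; rewrite lS lY.
- exists (K * L); first exact: mulr_ge0.
  by move=> u /=; rewrite (le_trans (SK _))// -mulrA ler_wpM2l.
- exists (L * K); first exact: mulr_ge0.
  by move=> u /=; rewrite (le_trans (YL _))// -mulrA ler_wpM2l.
- move=> _ [Z cZ ->] /=; rewrite (SY (Y \o Z)) ?(SY Z)//; exact: commutant_comp.
- move=> e e0; have [Z cZ h] := faithful_cyclic X2b X2sa fth2 x e0.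
  by exists (Z xi2) => //; exists Z.
Qed.

(** On the dense vectors [Y xi2], [W S] and [T W] agree because [W Y V] commutes with [T]. At
    [z = V x] the projections [V W] and [W V] are then moved past [S] and [T] and absorbed by
    [V]. *)
Lemma corresponds_intertwine T S : corresponds T S -> forall x, S (V x) = V (T x).
Proof.
move=> [NT NS e] x.
have [lT [K K0 TK]] := (bounded_operatorP _).1 (commutant_bounded NT).
have [lS [L L0 SL]] := (bounded_operatorP _).1 (commutant_bounded NS).
have [J J0 VJ] := it_bdd itV; have WJ := adj_bdd aV J0 VJ.
have h z : V (W (S z)) = V (T (W z)).
  apply: (@eq_on_limpt _ _ _ (V \o W \o S) (V \o T \o W) [set z | exists2 Z, commutant X2 Z & z = Z xi2]).
  - by move=> c u v /=; rewrite lS lW lV.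
  - by move=> c u v /=; rewrite lW lT lV.
  - exists (J * (J * L)); first by rewrite !mulr_ge0.
    move=> u /=; rewrite (le_trans (VJ _))// -!mulrA ler_wpM2l//.
    by rewrite (le_trans (WJ _))// ler_wpM2l.
  - exists (J * (K * J)); first by rewrite !mulr_ge0.
    move=> u /=; rewrite (le_trans (VJ _))// -!mulrA ler_wpM2l//.
    by rewrite (le_trans (TK _))// ler_wpM2l.
  - move=> _ [Y cY ->] /=; rewrite (comm_app (NS.2 _ cY)) e -(it_vec1 itV).
    have /= h := comm_app (NT.2 _ (compress_commutant cY)) xi1.
    by rewrite -h.
  - move=> d d0; have [Z cZ hZ] := faithful_cyclic X2b X2sa fth2 z d0.
    by exists (Z xi2) => //; exists Z.
have := h (V x); have /= <- := comm_app (NS.2 _ range_commutant) (V x).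
rewrite (it_isom itV) => ->.
have /= -> := comm_app (NT.2 _ source_commutant) x.
by rewrite (it_isom itV).
Qed.

Lemma corresponds_id : corresponds id id.
Proof.
split; [| |by rewrite (it_vec1 itV)].
  by apply: commutant_id; exact: commutant_bounded.
by apply: commutant_id; exact: commutant_bounded.
Qed.

Lemma correspondsD T T' S S' : corresponds T S -> corresponds T' S' ->
  corresponds (fun x => T x + T' x) (fun x => S x + S' x).
Proof.
move=> [NT NS e] [NT' NS' e']; split.
- by apply: commutantD => //; exact: commutant_bounded.
- by apply: commutantD => //; exact: commutant_bounded.
- by rewrite e e' (linD lV).
Qed.

Lemma correspondsZ (c : R[i]) T S : corresponds T S ->
  corresponds (fun x => c *: T x) (fun x => c *: S x).
Proof.
move=> [NT NS e]; split.
- by apply: commutantZ => //; exact: commutant_bounded.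
- by apply: commutantZ => //; exact: commutant_bounded.
- by rewrite e (linZ lV).
Qed.

Lemma corresponds_comp T T' S S' : corresponds T S -> corresponds T' S' ->
  corresponds (T \o T') (S \o S').
Proof.
move=> c [NT' NS' e']; have := corresponds_intertwine c; case: c => NT NS e h; split.
- exact: commutant_comp.
- exact: commutant_comp.
- by rewrite /= e' h.
Qed.

(** The adjoint [S''] of [S] commutes with [V W], so [S'' xi2] lies in the range of [V] and is
    determined by [W (S'' xi2)], which the intertwining relation identifies as [T' xi1]. *)
Lemma corresponds_adj T T' S S' : corresponds T S -> corresponds T' S' ->
  adj T T' -> adj S S'.
Proof.
move=> c c' a; have h := corresponds_intertwine c.
case: c c' => NT NS e [NT' NS' e'].
have [S'' NS'' a''] := bicommutant_has_adj X2sa NS.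
suff -> : S' = S'' by [].
apply: (faithful_separating X2b X2sa fth2) => //; rewrite e'.
have VW2 : V (W xi2) = xi2 by rewrite -(it_vec1 itV) (it_isom itV).
have /= h2 := comm_app (NS''.2 _ range_commutant) xi2.
rewrite VW2 in h2; rewrite h2; congr V.
apply: rip_inj => x.
by rewrite (adjC aV) (adjC a'') h -(adjC aV) (it_vec2 itV) (adjC a).
Qed.

(** Positivity is obtained without a root of [T]: [B = K - T] is positive of norm at most [K], and
    [reid_inequality] for [B] and a compression [M] says that [(xi1, M T xi1) >= 0]. This is the
    claim at the dense vectors [Y xi2]. *)
Lemma corresponds_pos T S : corresponds T S ->
  (forall x, 0 <= ip x (T x)) -> forall z, 0 <= ip z (S z).
Proof.
move=> c T0; have [NT NS e] := c.
have [lT [K K0 TK]] := (bounded_operatorP _).1 (commutant_bounded NT).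
have [lS [L L0 SL]] := (bounded_operatorP _).1 (commutant_bounded NS).
have aT := positive_adj lT T0; have aS := corresponds_adj c c aT.
have rT x : 0 <= rip x (T x) by have := T0 x; rewrite lecE => /andP[].
apply: adj_positive => // z.
pose B x := K%:C *: x - T x.
have aB : adj B B by move=> x y; rewrite /B ripBr ripBl ripZr ripZl aT.
have lB : linear B.
  by move=> a x y; rewrite /B lT scalerDr scalerBr !scalerA mulrC opprD addrACA.
have B0 x : 0 <= rip x (B x).
  rewrite /B ripBr ripZr subr_ge0 (le_trans (rip_le _ _))// -nr_sqr mulrC expr2 mulrA.
  by rewrite ler_wpM2r ?nr_ge0.
have BK1 x : rip x (B x) <= K * rip x x by rewrite /B ripBr ripZr gerBl.
have BK x : nr (B x) <= K * nr x.
  have h := @positive_form_norm R H1 x (B x) (B (B x)) K.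
  rewrite -ler_sqr ?nnegrE ?mulr_ge0 ?nr_ge0// exprMn !nr_sqr.
  apply: le_trans (h _ _ _ _) _ => //.
  - by move=> t; rewrite -(linZ lB _ (B x)) -(linD lB).
  - by rewrite expr2 -mulrA ler_wpM2l.
have pos Y : commutant X2 Y -> 0 <= rip (Y xi2) (S (Y xi2)).
  move=> cY; have [Y' cY' aY] := commutant_has_adj X2sa cY.
  rewrite (comm_app (NS.2 _ cY)) e -(it_vec1 itV).
  have cM := compress_commutant (commutant_comp cY' cY).
  set M := W \o (Y' \o Y) \o V in cM.
  have [lM [J J0 MJ]] := (bounded_operatorP _).1 (commutant_bounded cM).
  have ME x y : rip x (M y) = rip (Y (V x)) (Y (V y)).
    by rewrite /M/= (adjC aV) (adjC aY).
  have aM : adj M M by move=> x y; rewrite ME [RHS]ripC ME ripC.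
  have TM y : T (M y) = M (T y) by apply: comm_app; exact: NT.2.
  have := @reid_inequality R H1 M B K J xi1 lM aM => kr.
  rewrite -ME; suff : rip xi1 (M (B xi1)) <= K * rip xi1 (M xi1).
    by rewrite /B (linB lM) (linZ lM) ripBr ripZr gerBl.
  apply: kr => //.
  - by move=> x; rewrite ME rip_ge0.
  - by move=> x; rewrite /B (linB lM) (linZ lM) TM.
rewrite -[leRHS]addr0 -lerBlDl sub0r.
apply/ler_addgt0Pr => d d0.
have k0 : 0 < L * (2 * nr z + 1) + 1 by rewrite ltr_wpDl// mulr_ge0// addr_ge0// mulr_ge0// nr_ge0.
(* For [v = z - w] the error is at most [L |v| (2 |z| + |v|)]; the bound [|v| <= 1] makes it linear
   in [|v|]. *)
pose e' := Num.min 1 (d / (L * (2 * nr z + 1) + 1)).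
have e'0 : 0 < e' by rewrite lt_min ltr01 divr_gt0.
have [Y cY] := faithful_cyclic X2b X2sa fth2 z e'0.
rewrite lt_min => /andP[h1]; rewrite ltr_pdivlMr// => h2.
have := pos _ cY; set w := Y xi2 in h1 h2 *; move: h1 h2.
have -> : rip z (S z) = rip w (S w) + 2 * rip (z - w) (S z) - rip (z - w) (S (z - w)).
  by rewrite (linB lS) !ripE (aS z w) (ripC (S z) w); ring.
move: (z - w) => v h1 h2 h3.
have h4 : `|rip v (S z)| <= nr v * (L * nr z).
  by rewrite (le_trans (rip_cs _ _))// ler_wpM2l ?nr_ge0.
have h5 : rip v (S v) <= nr v * (L * nr v).
  by rewrite (le_trans (rip_le _ _))// ler_wpM2l ?nr_ge0.
have h6 : nr v * (L * nr v) <= 1 * (L * nr v).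
  by rewrite ler_wpM2r ?mulr_ge0 ?nr_ge0// ltW.
have h7 : - rip v (S z) <= `|rip v (S z)| by rewrite -normrN ler_norm.
have := nr_ge0 v; lra.
Qed.

End Intertwine.

(** * Order isomorphism and normality *)

Section Isomorphism.
Variables (R : realType) (H1 H2 : hilbert R).
Variables (X1 : set (H1 -> H1)) (xi1 : H1) (X2 : set (H2 -> H2)) (xi2 : H2).
Variables (V : H1 -> H2) (W : H2 -> H1).
Hypothesis X1sa : forall T, X1 T -> adj T T.
Hypothesis X2b : X2 `<=` @bounded_operator R H2.
Hypothesis X2sa : forall T, X2 T -> adj T T.
Hypothesis itV : intertwiner X1 xi1 X2 xi2 V W.
Hypothesis fth2 : faithful (vector_state xi2) (vna_generated X2).
Let C12 := corresponds X1 xi1 X2 xi2 V.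
Let C21 := corresponds X2 xi2 X1 xi1 W.

Lemma corresponds_sym T S : C12 T S -> C21 S T.
Proof.
move=> [NT NS e]; split => //; rewrite e.
have /= <- := comm_app (NT.2 _ (source_commutant X1sa X2b X2sa itV)) xi1.
by rewrite (it_vec1 itV) (it_vec2 itV).
Qed.

Lemma corresponds_le T S T' S' : C12 T S -> C12 T' S' -> op_le T T' -> op_le S S'.
Proof.
move=> c c' le x.
have d := correspondsD itV c' (correspondsZ itV (-1) c).
have /(_ _ x) := corresponds_pos X1sa X2b X2sa itV fth2 d.
by rewrite /= scaleN1r; apply => y; rewrite scaleN1r; exact: le.
Qed.

End Isomorphism.

Lemma intertwiner_isomorphism (R : realType) (H1 H2 : hilbert R)
    (X1 : set (H1 -> H1)) (xi1 : H1) (X2 : set (H2 -> H2)) (xi2 : H2)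
    (V : H1 -> H2) (W : H2 -> H1) :
  X1 `<=` @bounded_operator R H1 -> (forall T, X1 T -> adj T T) ->
  X2 `<=` @bounded_operator R H2 -> (forall T, X2 T -> adj T T) ->
  intertwiner X1 xi1 X2 xi2 V W ->
  faithful (vector_state xi1) (vna_generated X1) ->
  faithful (vector_state xi2) (vna_generated X2) ->
  exists f : (H1 -> H1) -> (H2 -> H2),
    [/\ vna_morphism (vna_generated X1) (vna_generated X2) f,
        normal_map (vna_generated X1) (vna_generated X2) f
      & forall T, vna_generated X1 T -> vector_state xi2 (f T) = vector_state xi1 T].
Proof.
move=> X1b X1sa X2b X2sa itV fth1 fth2.
have itW := intertwiner_sym X1sa X2sa itV.
pose C := corresponds X1 xi1 X2 xi2 V.
have /choice[f hf] : forall T, exists S, vna_generated X1 T -> C T S.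
  (* Outside the algebra the value is arbitrary; [id] is a default. *)
  move=> T; have [NT|nNT] := pselect (vna_generated X1 T); last by exists id.
  rewrite vna_generatedE// in NT.
  by have [S] := corresponds_exists X1sa X2b X2sa itV fth2 NT; exists S.
have fE T S : C T S -> f T = S.
  move=> c; apply: (corresponds_unique X2b X2sa fth2 _ c).
  by apply: hf; rewrite vna_generatedE//; case: c.
have gen1 T : commutant (commutant X1) T -> C T (f T).
  by move=> NT; apply: hf; rewrite vna_generatedE.
rewrite !vna_generatedE//.
exists f; split.
- split.
  + by move=> T /gen1[].
  + apply: fE; exact: (corresponds_id itV).
  + by move=> T U /gen1 cT /gen1 cU; apply: fE; exact: (correspondsD itV).
  + by move=> c T /gen1 cT; apply: fE; exact: (correspondsZ itV).
  + by move=> T U /gen1 cT /gen1 cU; apply: fE; exact: (corresponds_comp X1sa X2b X2sa itV fth2).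
  + move=> T U /gen1 cT /gen1 cU.
    have [lT _] := commutant_bounded (let: And3 a _ _ := cT in a).
    have [lS _] := commutant_bounded (let: And3 _ a _ := cT in a).
    move/(adjointP _ lT) => a; apply/(adjointP _ lS).
    exact: (corresponds_adj X1sa X2b X2sa itV fth2 cT cU).
- move=> F T Fsa _ [NT ub lub].
  have cT := gen1 _ NT.
  have cF U : F U -> C U (f U) by move=> /Fsa[NU _]; exact: gen1.
  split; first by case: cT.
    by move=> _ [U FU <-]; apply: (corresponds_le X1sa X2b X2sa itV fth2 (cF _ FU) cT); exact: ub.
  move=> S NS hS.
  (* An upper bound [S] of the image is pulled back to an upper bound [T'] of [F]; this uses
     faithfulness of the first state. *)
  have [T' cT'] := corresponds_exists X2sa X1b X1sa itW fth1 NS.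
  have cS := corresponds_sym X2sa X1b X1sa itW cT'.
  apply: (corresponds_le X1sa X2b X2sa itV fth2 cT cS); apply: lub.
    by case: cT'.
  move=> U FU; apply: (corresponds_le X2sa X1b X1sa itW fth1 _ cT' (hS _ _)).
    exact: (corresponds_sym X1sa X2b X2sa itV (cF _ FU)).
  by exists U.
- move=> T /gen1 [NT NS e]; rewrite /vector_state e.
  have aV := it_adj itV.
  by rewrite (adj_ip (it_lin itV) aV) (it_vec2 itV).
Qed.

(** * Spectral resolutions *)

Section SecondMoment.
Variable R : realType.
Implicit Types (mu nu : {measure set (measurableTypeR R) -> \bar R}).

Section Integrability.
Variable mu : {measure set (measurableTypeR R) -> \bar R}.
Hypothesis mufin : (mu setT < +oo)%E.
Hypothesis musq : (\int[mu]_t (t ^+ 2)%:E < +oo)%E.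

Lemma integrable_cst (D : set (measurableTypeR R)) (c : R) : measurable D -> 
  mu.-integrable D (EFin \o (fun=> c)).
Proof.
move=> mD; apply: (integrableS measurableT) => //.
by apply: measurable_bounded_integrable => //; exists `|c|; split => // y cy z _ /=; exact: ltW.
Qed.

Lemma integrable_sqr (D : set (measurableTypeR R)) : measurable D ->
  mu.-integrable D (EFin \o (fun t : measurableTypeR R => (t : R) ^+ 2)).
Proof.
move=> mD; apply: (integrableS measurableT) => //; apply/integrableP; split.
  by apply/measurable_EFinP; exact: measurable_funX.
by under eq_integral do rewrite /= ger0_norm ?sqr_ge0//.
Qed.

Lemma integrable_id (D : set (measurableTypeR R)) : measurable D ->
  mu.-integrable D (EFin \o (fun t : measurableTypeR R => (t : R))).
Proof.
move=> mD; have h := integrableD mD (integrable_cst 1 mD) (integrable_sqr mD).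
apply: (le_integrable mD _ _ h); first exact/measurable_EFinP.
move=> t _ /=; rewrite lee_fin [leRHS]ger0_norm ?addr_ge0 ?sqr_ge0//.
by rewrite ler_norml; apply/andP; split; nra.
Qed.

End Integrability.

Lemma integral_restr mu nu (D : set (measurableTypeR R)) f : measurable D ->
  (forall A, measurable A -> nu A = mu (A `&` D)) ->
  nu.-integrable setT f -> (\int[nu]_t f t = \int[mu]_(t in D) f t)%E.
Proof.
move=> mD h fi; rewrite (negligible_integral (measurableC mD))//.
  rewrite setTD setCK; apply: eq_measure_integral => A mA AD.
  by rewrite h// setIidl.
by rewrite h ?setICl ?measure0//; exact: measurableC.
Qed.

Lemma ge0_integral_restr mu nu (D : set (measurableTypeR R)) f : measurable D ->
  (forall A, measurable A -> nu A = mu (A `&` D)) ->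
  measurable_fun setT f -> (forall t, (0 <= f t)%E) ->
  (\int[nu]_t f t = \int[mu]_(t in D) f t)%E.
Proof.
move=> mD h mf f0; rewrite (ge0_negligible_integral (measurableC mD))//.
  rewrite setTD setCK; apply: eq_measure_integral => A mA AD.
  by rewrite h// setIidl.
by rewrite h ?setICl ?measure0//; exact: measurableC.
Qed.

End SecondMoment.

Lemma nr_pythagoras (R : realType) (H : hilbert R) (u v : H) :
  rip v u = 0 -> nr (v + u) ^+ 2 = nr u ^+ 2 + nr v ^+ 2.
Proof. by move=> h; rewrite !nr_sqr !ripE (ripC u) h !add0r addr0 addrC. Qed.

Section ResolutionOfIdentity.
Variables (R : realType) (H : hilbert R) (E : resolution_of_identity H).
Implicit Types (s t : R) (x : H).
Let mu := spectral_measure E.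

Lemma roi_lin t : linear (E t).
Proof. by have [[]] := roi_proj E t. Qed.

Lemma roi_bounded t : bounded_operator (E t).
Proof. by have [] := roi_proj E t. Qed.

Lemma roi_idem t x : E t (E t x) = E t x.
Proof. by have [_ h _] := roi_proj E t; rewrite -[RHS](congr1 (fun f => f x) h). Qed.

Lemma roi_adj t : adj (E t) (E t).
Proof. by have [_ _ h] := roi_proj E t; apply/adjointP => //; exact: roi_lin. Qed.

Lemma roi_funE x t : roi_fun E x t = rip (E t x) (E t x).
Proof. by rewrite -roi_adj roi_idem. Qed.

Lemma roi_compl_idem t x : E t (x - E t x) = 0.
Proof. by rewrite (linB (roi_lin t)) roi_idem subrr. Qed.

Lemma roi_pyth t x : nr x ^+ 2 = nr (E t x) ^+ 2 + nr (x - E t x) ^+ 2.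
Proof.
have o : rip (x - E t x) (E t x) = 0 by rewrite roi_adj roi_compl_idem rip0l.
by rewrite -(nr_pythagoras o) subrK.
Qed.

(** Monotonicity of the quadratic forms says that the projection [E t] does not shorten [E s x]; by
    Pythagoras it fixes it. *)
Lemma roi_le s t x : s <= t -> E t (E s x) = E s x.
Proof.
move=> st; apply/eqP; rewrite eq_sym -subr_eq0; apply/eqP/nr_eq0/eqP.
rewrite -sqrf_eq0 eq_le sqr_ge0 andbT.
have := roi_pyth t (E s x); have := roi_mono E st (E s x).
rewrite lecE => /andP[_]; rewrite -/(rip _ _) ripBr subr_ge0 !nr_sqr roi_idem.
have -> : rip (E s x) (E t (E s x)) = rip (E t (E s x)) (E t (E s x)).
  by rewrite -{1}(roi_idem t (E s x)) roi_adj.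
lra.
Qed.

Lemma roi_ge s t x : s <= t -> E s (E t x) = E s x.
Proof.
by move=> st; apply: rip_inj => y; rewrite roi_adj roi_adj roi_le// -roi_adj.
Qed.

Lemma roi_cvg_pinfty x e : 0 < e -> exists M, forall s, M < s -> nr (x - E s x) < e.
Proof.
move=> e0; have /nr_cvgP/(_ e e0)[M [_ h]] := @roi_pinfty _ _ E x; by exists M.
Qed.

Lemma roi_cvg_ninfty x e : 0 < e -> exists M, forall s, s < M -> nr (E s x) < e.
Proof.
move=> e0; have /nr_cvgP/(_ e e0)[M [_ h]] := @roi_ninfty _ _ E x; exists M => s sM.
by have := h s sM; rewrite sub0r nrN.
Qed.

Lemma roi_cvg_right t x e : 0 < e -> exists2 s, t < s & nr (E t x - E s x) < e.
Proof.
move=> e0; have /nr_cvgP/(_ e e0) h := @roi_right _ _ E t x.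
near t^'+ => s; exists s; first by near: s; exact: nbhs_right_gt.
by near: s.
Unshelve. all: by end_near. Qed.

Lemma spectral_measure_itv x s t : s <= t ->
  mu x `]s, t]%classic = (roi_fun E x t - roi_fun E x s)%:E.
Proof.
move=> st; rewrite /mu/= /spectral_measure/= /lebesgue_stieltjes_measure /measure_extension.
rewrite measurable_mu_extE/=; last exact: is_ocitv.
by rewrite wlength_itv_bnd.
Qed.

Lemma spectral_measureT x : mu x setT = (nr x ^+ 2)%:E.
Proof.
rewrite -(bigcup_itvT false false).
pose I n : set R := `]- (n%:R), n%:R]%classic.
have : (mu x \o I) n @[n --> \oo] --> mu x (\bigcup_n I n).
  apply: nondecreasing_cvg_mu; rewrite /I//; first exact: bigcup_measurable.
  by move=> *; apply/subsetPset/subset_itv; rewrite leBSide/= ?lerN2 ler_nat.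
suff : (mu x \o I) n @[n --> \oo] --> (nr x ^+ 2)%:E by move=> + h; exact: cvg_unique.
have -> : mu x \o I = (fun n => (roi_fun E x n%:R - roi_fun E x (- n%:R))%:E).
  by apply/funext => n; rewrite /= spectral_measure_itv// ge0_cp.
apply/cvg_EFin; first by near=> n.
apply/cvgrPdist_lt => e e0.
have k0 : 0 < e / 2 / (nr x + 1) by rewrite !divr_gt0// ltr_wpDl ?nr_ge0.
have [M hM] := roi_cvg_pinfty x k0; have [L hL] := roi_cvg_ninfty x k0.
near=> n.
have nM : M < n%:R by near: n; exact: nbhs_infty_gtr.
have nL : - n%:R < L by rewrite ltrNl; near: n; exact: nbhs_infty_gtr.
have -> : nr x ^+ 2 - ((fine \o (fun n => (roi_fun E x n%:R - roi_fun E x (- n%:R))%:E)) n)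
    = rip x (x - E n%:R x) + rip x (E (- n%:R) x).
  by rewrite /= nr_sqr ripBr /roi_fun -!/(rip _ _); ring.
have h u : nr u < e / 2 / (nr x + 1) -> `|rip x u| < e / 2.
  move=> hu; apply: le_lt_trans (rip_cs _ _) _.
  have x1 : 0 < nr x + 1 by rewrite ltr_wpDl ?nr_ge0.
  move: hu; rewrite ltr_pdivlMr// mulrDr mulr1 mulrC; apply: le_lt_trans.
  by rewrite lerDl nr_ge0.
rewrite (le_lt_trans (ler_normD _ _))// [e]splitr ltrD// h//.
  exact: hM.
exact: hL.
Unshelve. all: by end_near. Qed.

Lemma spectral_measure_fin x : (mu x setT < +oo)%E.
Proof. by rewrite spectral_measureT ltry. Qed.

Lemma itv_oc_capNy (a b s : R) :
  `]a, b]%classic `&` `]-oo, s]%classic = `]a, Num.min b s]%classic.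
Proof.
apply/seteqP; split=> z /=; rewrite !in_itv/= le_min.
  by move=> [/andP[-> ->] ->].
by move=> /and3P[-> -> ->].
Qed.

Lemma itv_oc_capy (a b s : R) :
  `]a, b]%classic `&` `]s, +oo[%classic = `]Num.max a s, b]%classic.
Proof.
apply/seteqP; split=> z /=; rewrite !in_itv/= gt_max ?andbT.
  by move=> [/andP[-> ->] ->].
by move=> /andP[/andP[-> ->] ->].
Qed.

(** Half-open intervals determine a Lebesgue-Stieltjes measure, and the distribution function of
    [E s x] is that of [x] stopped at [s]. The complementary projection is treated likewise, with
    [max] in place of [min]. *)
Lemma spectral_measure_low s x A : measurable A ->
  mu (E s x) A = mu x (A `&` `]-oo, s]%classic).
Proof.
have mD : measurable (`]-oo, s]%classic : set (measurableTypeR R)) by exact: measurable_itv.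
move=> mA; rewrite /mu /spectral_measure.
apply: (lebesgue_stieltjes_measure_unique (mu := mrestr (mu x) mD)) => // X /ocitvP[->|[[a b] /= ab ->]].
  by rewrite !measure0.
rewrite [LHS](spectral_measure_itv _ (ltW ab)) /mrestr itv_oc_capNy.
have FE t : roi_fun E (E s x) t = roi_fun E x (Num.min t s).
  rewrite !roi_funE; have [ts|/ltW st] := leP t s; first by rewrite roi_ge.
  by rewrite roi_le.
rewrite !FE; have [as_|sa] := leP a s.
  rewrite spectral_measure_itv; last by rewrite le_min as_ ltW.
  by [].
have -> : `]a, Num.min b s]%classic = set0 :> set R.
  by apply/seteqP; split=> z //=; rewrite in_itv/= le_min => /and3P[h1 h2 h3]; lra.
by rewrite measure0 (min_idPr _) ?subrr// (le_trans (ltW sa))// ltW.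
Qed.

Lemma spectral_measure_high s x A : measurable A ->
  mu (x - E s x) A = mu x (A `&` `]s, +oo[%classic).
Proof.
have mD : measurable (`]s, +oo[%classic : set (measurableTypeR R)) by exact: measurable_itv.
move=> mA; rewrite /mu /spectral_measure.
apply: (lebesgue_stieltjes_measure_unique (mu := mrestr (mu x) mD)) => // X /ocitvP[->|[[a b] /= ab ->]].
  by rewrite !measure0.
rewrite [LHS](spectral_measure_itv _ (ltW ab)) /mrestr itv_oc_capy.
have FE t : roi_fun E (x - E s x) t = roi_fun E x (Num.max t s) - roi_fun E x s.
  rewrite [LHS]roi_funE (linB (roi_lin t)); have [ts|/ltW st] := leP t s.
    by rewrite roi_ge// subrr rip0l subrr.
  rewrite roi_le// !roi_funE ripBl !ripBr.
  have e : rip (E t x) (E s x) = rip (E s x) (E s x).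
    by rewrite -(roi_adj t) roi_le// -{1}(roi_idem s x) roi_adj.
  by rewrite (ripC (E s x) (E t x)) e; ring.
rewrite !FE opprB addrA subrK; have [sb|bs] := leP s b.
  by rewrite spectral_measure_itv ?(max_idPl sb)// ge_max sb ltW.
have -> : `]Num.max a s, b]%classic = set0 :> set R.
  by apply/seteqP; split=> z //=; rewrite in_itv/= gt_max => /andP[/andP[h1 h2] h3]; lra.
by rewrite measure0 (max_idPr _) ?subrr// (le_trans (ltW ab))// ltW.
Qed.

End ResolutionOfIdentity.

(** * Commutation with the spectral projections and norm bounds on spectral bands *)

Section SelfadjointSpectral.
Variables (R : realType) (H : hilbert R) (T : unbounded_operator H).
Variable E : resolution_of_identity H.
Hypothesis saT : selfadjoint T.
Hypothesis srT : spectral_resolution T E.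
Implicit Types (s t : R) (x y z : H).
Let mu := spectral_measure E.
Let dom := op_dom T.

Lemma dom_linspace : linspace dom.
Proof. by split; [exact: sa_dom0|move=> c x y dx dy; have [] := sa_linear saT c dx dy]. Qed.

Lemma sa_D x y : dom x -> dom y -> T (x + y) = T x + T y.
Proof. by move=> dx dy; have [_] := sa_linear saT 1 dx dy; rewrite !scale1r. Qed.

Lemma sa_0 : T 0 = 0.
Proof. by apply: (addrI (T 0)); rewrite -sa_D ?addr0//; exact: sa_dom0. Qed.

Lemma sa_Z (c : R[i]) x : dom x -> T (c *: x) = c *: T x.
Proof.
by move=> dx; have [_] := sa_linear saT c dx (sa_dom0 saT); rewrite sa_0 !addr0.
Qed.

Lemma sa_B x y : dom x -> dom y -> T (x - y) = T x - T y.
Proof.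
move=> dx dy; rewrite -scaleN1r sa_D//; last exact: (linspaceZ _ dom_linspace).
by rewrite sa_Z// scaleN1r.
Qed.

Lemma sa_sym x y : dom x -> dom y -> rip y (T x) = rip (T y) x.
Proof. by move=> dx dy; rewrite /rip (((sa_adjoint saT y (T y)).2 _) x). Qed.

(** Real parts suffice because the domain is stable under ['i]. *)
Lemma sa_weak x z : (forall y, dom y -> rip x (T y) = rip z y) -> dom x /\ T x = z.
Proof.
move=> h; apply/(sa_adjoint saT) => y dy.
have diy : dom ('i *: y) by exact: (linspaceZ _ dom_linspace).
by rewrite !ipE -sa_Z// !h.
Qed.

Lemma dom_ext u : (forall x, dom x -> rip x u = 0) -> u = 0.
Proof.
move=> h; have o := rip_orth dom_linspace h; apply/ip_eq0/(ip_limpt0 o) => e e0.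
by have /dense_nr/(_ u e e0) := sa_dense saT.
Qed.

Lemma dom_sqr x : dom x -> (\int[mu x]_t (t ^+ 2)%:E < +oo)%E.
Proof. by move/(sr_dom srT). Qed.

Let fin x : (mu x setT < +oo)%E := spectral_measure_fin E x.
Let mlow s : measurable (`]-oo, s]%classic : set (measurableTypeR R)).
Proof. exact: measurable_itv. Qed.
Let mhigh s : measurable (`]s, +oo[%classic : set (measurableTypeR R)).
Proof. exact: measurable_itv. Qed.

Lemma rip_sa x : dom x -> rip x (T x) = \int[mu x]_t t.
Proof. by move=> dx; rewrite /rip (sr_val srT). Qed.

Lemma dom_low s x : dom x -> dom (E s x).
Proof.
move=> dx; apply/(sr_dom srT).
have ms : measurable_fun setT (fun t : measurableTypeR R => ((t : R) ^+ 2)%:E).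
  by apply/measurable_EFinP; exact: measurable_funX.
rewrite (ge0_integral_restr (mlow s) (spectral_measure_low E s x))//; last first.
  by move=> t; rewrite lee_fin sqr_ge0.
apply: le_lt_trans (dom_sqr dx); apply: ge0_subset_integral => //.
by move=> t _; rewrite lee_fin sqr_ge0.
Qed.

Lemma dom_high s x : dom x -> dom (x - E s x).
Proof. by move=> dx; apply: (linspaceB dom_linspace) => //; exact: dom_low. Qed.

Lemma rip_low s x : dom x ->
  rip (E s x) (T (E s x)) = \int[mu x]_(t in `]-oo, s]) t.
Proof.
move=> dx; rewrite rip_sa; last exact: dom_low.
rewrite /Rintegral (integral_restr (mlow s) (spectral_measure_low E s x))//.
by apply: integrable_id => //; exact/dom_sqr/dom_low.
Qed.

Lemma rip_high s x : dom x ->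
  rip (x - E s x) (T (x - E s x)) = \int[mu x]_(t in `]s, +oo[) t.
Proof.
move=> dx; rewrite rip_sa; last exact: dom_high.
rewrite /Rintegral (integral_restr (mhigh s) (spectral_measure_high E s x))//.
by apply: integrable_id => //; exact/dom_sqr/dom_high.
Qed.

Lemma rip_split s x : dom x -> rip x (T x) =
  rip (E s x) (T (E s x)) + rip (x - E s x) (T (x - E s x)).
Proof.
move=> dx; rewrite rip_low// rip_high// rip_sa//.
rewrite -Rintegral_setU//.
- congr Rintegral; apply/esym/seteqP; split=> // t _ /=; rewrite !in_itv/= andbT.
  by have [h|h] := leP t s; [left|right].
- by apply: integrable_id => //; [exact: dom_sqr|exact: measurableU].
- apply/disj_setPS => t /= []; rewrite !in_itv/= andbT => h1 h2; lra.
Qed.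

(** The diagonal form splits along [E s] by [rip_split]. Applied to [a + b], whose lower part is
    [a], this cancels everything except twice the cross term; commutation in [sa_low] follows. *)
Lemma rip_cross s x y : dom x -> dom y -> rip (E s x) (T (y - E s y)) = 0.
Proof.
move=> dx dy; set a := E s x; set b := y - E s y.
have da : dom a by exact: dom_low.
have db : dom b by exact: dom_high.
have dz : dom (a + b) by exact: (linspaceD dom_linspace).
have := rip_split s dz.
have -> : E s (a + b) = a.
  by rewrite (linD (roi_lin E s)) /a /b roi_idem roi_compl_idem addr0.
clearbody a b; rewrite [a + b - a]addrC addKr sa_D// !ripE (sa_sym da db) (ripC (T b)).
lra.
Qed.

Lemma sa_low s y : dom y -> E s (T y) = T (E s y).
Proof.
move=> dy.
have h1 : E s (T (y - E s y)) = 0.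
  by apply: dom_ext => x dx; rewrite roi_adj rip_cross.
have h2 : T (E s y) - E s (T (E s y)) = 0.
  apply: dom_ext => x dx; rewrite ripBr roi_adj -ripBl.
  by rewrite (sa_sym (dom_low s dy) (dom_high s dx)) ripC (rip_cross s dy dx).
rewrite -{1}[y](subrK (E s y)) sa_D; [|exact: dom_high|exact: dom_low].
by rewrite (linD (roi_lin E s)) h1 add0r; apply/eqP; rewrite eq_sym -subr_eq0 h2.
Qed.

Lemma sa_high s y : dom y -> T (y - E s y) = T y - E s (T y).
Proof. by move=> dy; rewrite sa_B ?sa_low//; exact: dom_low. Qed.

Lemma dom_band s t x : E t x = x -> E s x = 0 -> dom x.
Proof.
move=> xt xs; apply/(sr_dom srT).
have ms : measurable_fun setT (fun t : measurableTypeR R => ((t : R) ^+ 2)%:E).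
  by apply/measurable_EFinP; exact: measurable_funX.
have mD : measurable (`]-oo, t]%classic `&` `]s, +oo[%classic : set (measurableTypeR R)).
  exact: measurableI.
have h A : measurable A -> mu x A = mu x (A `&` (`]-oo, t] `&` `]s, +oo[)).
  move=> mA; rewrite setIA -(spectral_measure_high E); last exact: measurableI.
  rewrite xs subr0 -[in RHS](spectral_measure_low E t)// xt//.
rewrite (ge0_integral_restr mD h)//; last by move=> u; rewrite lee_fin sqr_ge0.
apply: integrable_lty => //.
apply: (@measurable_bounded_integrable _ _ _ (mu x) (fun t : measurableTypeR R => (t : R) ^+ 2)) => //.
- by apply: le_lt_trans (fin x); apply: le_measure; rewrite ?inE.
(* This bounds [u ^+ 2] on []s, t]] whatever the signs of [s] and [t]. *)
exists (s ^+ 2 + t ^+ 2); split; first exact: num_real.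
move=> c hc u /=; rewrite !in_itv/= andbT => -[h1 h2].
rewrite ger0_norm ?sqr_ge0// (le_trans _ (ltW hc))//.
by have [u0|u0] := leP 0 (u : R); nra.
Qed.

Lemma rip_upper t x : dom x -> E t x = x -> rip x (T x) <= t * nr x ^+ 2.
Proof.
move=> dx xt; have := rip_low t dx; rewrite xt => ->.
have -> : t * nr x ^+ 2 = \int[mu x]_(u in `]-oo, t]) t.
  rewrite Rintegral_cst//; congr (_ * _).
  have := spectral_measure_low E t x measurableT.
  by rewrite spectral_measureT setTI xt => <-.
apply: le_Rintegral => //.
- exact: (integrable_id (fin x) (dom_sqr dx) (mlow t)).
- exact: (integrable_cst (fin x) t (mlow t)).
Qed.

Lemma rip_lower s x : dom x -> E s x = 0 -> s * nr x ^+ 2 <= rip x (T x).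
Proof.
move=> dx xs; have := rip_high s dx; rewrite xs subr0 => ->.
have -> : s * nr x ^+ 2 = \int[mu x]_(u in `]s, +oo[) s.
  rewrite Rintegral_cst//; congr (_ * _).
  have := spectral_measure_high E s x measurableT.
  by rewrite spectral_measureT setTI xs subr0 => <-.
apply: le_Rintegral => //.
- exact: (integrable_cst (fin x) s (mhigh s)).
- exact: (integrable_id (fin x) (dom_sqr dx) (mhigh s)).
- by move=> u /=; rewrite in_itv/= andbT => /ltW.
Qed.

Lemma band_T s t x : E t x = x -> E s x = 0 -> E t (T x) = T x /\ E s (T x) = 0.
Proof.
by move=> xt xs; have dx := dom_band xt xs; rewrite !sa_low// xt xs sa_0.
Qed.

Lemma band_lin s (c : R[i]) x y t : E t x = x -> E s x = 0 -> E t y = y -> E s y = 0 ->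
  E t (c *: x + y) = c *: x + y /\ E s (c *: x + y) = 0.
Proof.
by move=> xt xs yt ys; rewrite !(roi_lin E) xt yt xs ys scaler0 addr0.
Qed.

Lemma band_shift s t x : E t x = x -> E s x = 0 ->
  E t (T x - s%:C *: x) = T x - s%:C *: x /\ E s (T x - s%:C *: x) = 0.
Proof.
move=> xt xs; have [h1 h2] := band_T xt xs.
by rewrite addrC -scaleNr; exact: band_lin.
Qed.

(** On the band, [0 <= T - s <= t - s] as quadratic forms, and [positive_form_norm] turns this into
    [(T - s)^2 <= (t - s) (T - s)]. The right-hand side stays a form value because [band_bisect]
    evaluates it as an integral. *)
Lemma band_norm_sqr s t x : s <= t -> E t x = x -> E s x = 0 ->
  rip (T x - s%:C *: x) (T x - s%:C *: x) <= (t - s) * rip x (T x - s%:C *: x).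
Proof.
move=> st xt xs; have dx := dom_band xt xs.
set y := T x - s%:C *: x; have [yt ys] := band_shift xt xs; rewrite -/y in yt ys.
have dy := dom_band yt ys.
apply: (@positive_form_norm _ _ _ _ (T y - s%:C *: y)).
- move=> r; have [wt ws] := band_lin r%:C yt ys xt xs; have dw := dom_band wt ws.
  have := rip_lower dw ws; rewrite sa_D ?sa_Z//; last exact: (linspaceZ _ dom_linspace).
  rewrite nr_sqr [r%:C *: y + x]addrC -subr_ge0 /y; congr (_ <= _).
  rewrite scalerBr scalerBr !scalerA (mulrC r%:C) !(ripDr, ripNr, ripZr) -!scalerA.
  rewrite !(ripDr, ripNr, ripZr); ring.
- by rewrite ripBr ripZr (sa_sym dy dx) -ripZl -ripBl.
- by rewrite subr_ge0.
- by rewrite ripBr ripZr mulrBl lerD2r -nr_sqr rip_upper.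
Qed.

Lemma band_norm s t x : s <= t -> E t x = x -> E s x = 0 ->
  nr (T x - s%:C *: x) <= (t - s) * nr x.
Proof.
move=> st xt xs; have := band_norm_sqr st xt xs; set y := T x - _.
have [->|y0] := eqVneq (nr y) 0; first by rewrite mulr_ge0 ?nr_ge0 ?subr_ge0.
have yp : 0 < nr y by rewrite lt0r y0 nr_ge0.
rewrite -nr_sqr => h; rewrite -(ler_pM2r yp) -expr2 (le_trans h)// -mulrA.
by rewrite ler_wpM2l ?subr_ge0// rip_le.
Qed.

End SelfadjointSpectral.

(** * Bounding the norm by the second moment *)

Lemma le_of_geometric (R : realType) (a b c : R) : 0 <= c ->
  (forall n, a <= b + c / 4 ^+ n) -> a <= b.
Proof.
move=> c0 h; apply/ler_addgt0Pr => e e0.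
have ce : 0 <= c / e by rewrite divr_ge0// ltW.
have := archi_boundP ce; set n := Num.bound _ => hn.
apply: le_trans (h n) _; rewrite lerD2l ler_pdivrMr ?exprn_gt0// mulrC -ler_pdivrMr//.
by rewrite (le_trans (ltW hn))// -natrX ler_nat ltnW// ltn_expl.
Qed.

Section NormBound.
Variables (R : realType) (H : hilbert R) (T : unbounded_operator H).
Variable E : resolution_of_identity H.
Hypothesis saT : selfadjoint T.
Hypothesis srT : spectral_resolution T E.
Variable x : H.
Hypothesis dx : op_dom T x.
Let mu := spectral_measure E x.
Let band s t := E t x - E s x.
Let itv s t : set (measurableTypeR R) := `]s, t]%classic.
Let mitv s t : measurable (itv s t).
Proof. exact: measurable_itv. Qed.
Let finmu : (mu setT < +oo)%E := spectral_measure_fin E x.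
Let sqmu := dom_sqr srT dx.
Let dom_bandx s t : op_dom T (band s t).
Proof. by apply: (linspaceB (dom_linspace saT)); exact: (dom_low srT). Qed.

Let band_top s t : s <= t -> E t (band s t) = band s t.
Proof. by move=> st; rewrite (linB (roi_lin E t)) roi_idem roi_le. Qed.

Let band_bot s t : s <= t -> E s (band s t) = 0.
Proof. by move=> st; rewrite (linB (roi_lin E s)) roi_idem roi_ge// subrr. Qed.

Let band_measure s t A : s <= t -> measurable A ->
  spectral_measure E (band s t) A = mu (A `&` itv s t).
Proof.
move=> st mA; have -> : band s t = E t x - E s (E t x) by rewrite roi_ge.
rewrite spectral_measure_high// spectral_measure_low; last first.
  by apply: measurableI => //; exact: measurable_itv.
congr (mu _); rewrite -setIA; congr (_ `&` _); apply/seteqP; split=> u; rewrite /itv /=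
  !in_itv/= andbT; first by move=> [-> ->].
by move=> /andP[-> ->].
Qed.

Let band_val s t : s <= t -> rip (band s t) (T (band s t)) = \int[mu]_(u in itv s t) u.
Proof.
move=> st; rewrite (rip_sa srT (dom_bandx s t)).
have h A : measurable A -> spectral_measure E (band s t) A = mu (A `&` itv s t).
  by move=> mA; exact: band_measure.
rewrite /Rintegral (integral_restr (mitv s t) h) => [//|].
exact: (integrable_id (spectral_measure_fin E _) (dom_sqr srT (dom_bandx s t)) measurableT).
Qed.

Let band_mass s t : s <= t -> nr (band s t) ^+ 2 = fine (mu (itv s t)).
Proof.
move=> st; have := band_measure st measurableT.
by rewrite spectral_measureT setTI => <-.
Qed.

Let mid (s t : R) : s <= t -> s <= (s + t) / 2 <= t.
Proof. by move=> st; apply/andP; split; lra. Qed.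

(** For [n = 0], [band_norm_sqr] reads [T^2 <= (s + t) T - s t], and [(s + t) u - s t = u^2 + (t -
    s)^2 / 4 - (u - (s + t) / 2)^2]. The two halves of a band are orthogonal, as are their images
    under [T], so bisecting divides the error by [4]. *)
Let band_bisect n s t : s <= t -> rip (T (band s t)) (T (band s t)) <=
  \int[mu]_(u in itv s t) (u ^+ 2) + (t - s) ^+ 2 / 4 ^+ n.+1 * nr (band s t) ^+ 2.
Proof.
elim: n s t => [|n IH] s t st.
  have := band_norm_sqr saT srT st (band_top st) (band_bot st).
  have h p : rip (T p - s%:C *: p) (T p - s%:C *: p) <= (t - s) * rip p (T p - s%:C *: p) ->
      rip (T p) (T p) <= (s + t) * rip p (T p) - s * t * nr p ^+ 2.
    by rewrite !ripE (ripC (T p) p) nr_sqr; lra.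
  move/h/le_trans; apply; rewrite band_val// band_mass//.
  have I1 := integrable_id finmu sqmu (mitv s t).
  have I2 := integrable_sqr sqmu (mitv s t).
  have Ic c := integrable_cst finmu c (mitv s t).
  have -> : (s + t) * \int[mu]_(u in itv s t) u - s * t * fine (mu (itv s t)) =
      \int[mu]_(u in itv s t) ((s + t) * (u : R) + - (s * t)).
    rewrite RintegralD//; last exact: (integrableZl (mitv s t) (s + t) I1).
    by rewrite RintegralZl// Rintegral_cst// mulNr.
  rewrite expr1 -Rintegral_cst// -RintegralD//; apply: le_Rintegral => //.
  - exact: (integrableD (mitv s t) (integrableZl (mitv s t) (s + t) I1) (Ic _)).
  - exact: (integrableD (mitv s t) I2 (Ic _)).
  - move=> u _; rewrite -subr_ge0.
    have -> : (u : R) ^+ 2 + (t - s) ^+ 2 / 4 - ((s + t) * (u : R) + - (s * t)) =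
      ((u : R) - (s + t) / 2) ^+ 2 by field.
    exact: sqr_ge0.
set m := (s + t) / 2; have /andP[sm mt] := mid st; rewrite -/m in sm mt.
have pE : band s t = band m t + band s m by rewrite /band addrA subrK.
have tE : T (band s t) = T (band m t) + T (band s m) by rewrite pE (sa_D saT).
have o : rip (band m t) (band s m) = 0.
  by rewrite -(band_top sm) roi_adj band_bot// rip0l.
have oT : rip (T (band m t)) (T (band s m)) = 0.
  rewrite -(band_top sm) -(sa_low saT srT _ (dom_bandx s m)) roi_adj.
  by rewrite (sa_low saT srT _ (dom_bandx m t)) band_bot// (sa_0 saT) rip0l.
have nT : rip (T (band s t)) (T (band s t)) =
    rip (T (band s m)) (T (band s m)) + rip (T (band m t)) (T (band m t)).
  by rewrite tE -!nr_sqr nr_pythagoras.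
rewrite nT pE nr_pythagoras//.
have -> : itv s t = itv s m `|` itv m t.
  apply/seteqP; split=> u; rewrite /itv/= !in_itv/=.
    by move=> /andP[h1 h2]; have [h|h] := leP u m; [left|right]; rewrite ?h1 ?h2 ?h.
  move=> [/andP[h1 h2]|/andP[h1 h2]]; apply/andP; split=> //.
    exact: le_trans mt.
  exact: le_lt_trans h1.
rewrite Rintegral_setU//; last 2 first.
- by apply: integrable_sqr => //; exact: measurableU.
- by apply/disj_setPS => u /= []; rewrite /itv/= !in_itv/= => /andP[h1 h2] /andP[h3 h4]; lra.
have := IH _ _ sm; have := IH _ _ mt.
have e1 : (t - m) ^+ 2 = (t - s) ^+ 2 / 4 by rewrite /m; field.
have e2 : (m - s) ^+ 2 = (t - s) ^+ 2 / 4 by rewrite /m; field.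
have e3 (u : R) : u / 4 / 4 ^+ n.+1 = u / 4 ^+ n.+2 by rewrite -mulrA -invfM -exprS.
rewrite e1 e2 e3 mulrDr => h1 h2; apply: le_trans (lerD h2 h1) _.
by rewrite addrACA [X in _ + X]addrC.
Qed.

(* The spectral resolution is only known weakly, so the norm identity is obtained
   by bisecting a spectral band; the error term of [band_bisect] then vanishes. *)
Lemma sa_norm_le : rip (T x) (T x) <= \int[mu]_t (t ^+ 2).
Proof.
set I := \int[mu]_t _.
have I0 : 0 <= I by apply: Rintegral_ge0 => u _; exact: sqr_ge0.
have le1 s t : s <= t -> nr (T (band s t)) ^+ 2 <= I.
  move=> st; rewrite nr_sqr.
  have : \int[mu]_(u in itv s t) (u ^+ 2) <= I.
    rewrite /I /Rintegral fine_le//.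
    - exact/integrable_fin_num/integrable_sqr.
    - exact/integrable_fin_num/integrable_sqr.
    - apply: ge0_subset_integral => //; first by apply/measurable_EFinP; exact: measurable_funX.
      by move=> u _; rewrite lee_fin sqr_ge0.
  apply: le_trans.
  apply: (@le_of_geometric _ _ _ ((t - s) ^+ 2 * nr (band s t) ^+ 2)).
    by rewrite mulr_ge0 ?sqr_ge0.
  move=> n; apply: le_trans (band_bisect n st) _; rewrite lerD2l mulrAC.
  apply: ler_wpM2l; first by rewrite mulr_ge0 ?sqr_ge0.
  rewrite lef_pV2 ?posrE ?exprn_gt0//.
  by rewrite exprS ler_peMl ?exprn_ge0// ler1n.
have : nr (T x) <= Num.sqrt I.
  apply/ler_addgt0Pr => e e0.
  have e2 : 0 < e / 2 by rewrite divr_gt0.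
  have [M hM] := roi_cvg_pinfty E (T x) e2; have [L hL] := roi_cvg_ninfty E (T x) e2.
  pose t := M + 1; pose s := Num.min (L - 1) t.
  have st : s <= t by rewrite ge_min lexx orbT.
  have tM : nr (T x - E t (T x)) < e / 2 by apply: hM; rewrite /t ltrDl.
  have sL : nr (E s (T x)) < e / 2.
    by apply: hL; rewrite /s gt_min gtrBl ltr01.
  have -> : T x = T (band s t) + (E s (T x) + (T x - E t (T x))).
    rewrite (sa_B saT); [|exact: (dom_low srT)|exact: (dom_low srT)].
    by rewrite -!(sa_low saT srT)// addrA subrK addrC subrK.
  apply: le_trans (nrD _ _) _; apply: lerD.
    rewrite -[leLHS]ger0_norm ?nr_ge0// -sqrtr_sqr ler_sqrt//; exact: le1.
  by rewrite [e]splitr (le_trans (nrD _ _))// lerD// ltW.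
move=> h; rewrite -nr_sqr -[leRHS](sqr_sqrtr I0).
by rewrite ler_sqr ?nnegrE ?nr_ge0 ?sqrtr_ge0.
Qed.

End NormBound.

(** * From intertwined operators to intertwined spectral projections *)

Definition graph_intertwines (R : realType) (H1 H2 : hilbert R)
    (T1 : unbounded_operator H1) (T2 : unbounded_operator H2) (V : H1 -> H2) :=
  forall x, op_dom T1 x -> op_dom T2 (V x) /\ T2 (V x) = V (T1 x).

Section SpectralIntertwining.
Variables (R : realType) (H1 H2 : hilbert R).
Variables (T1 : unbounded_operator H1) (E1 : resolution_of_identity H1).
Variables (T2 : unbounded_operator H2) (E2 : resolution_of_identity H2).
Hypothesis sa1 : selfadjoint T1.
Hypothesis sr1 : spectral_resolution T1 E1.
Hypothesis sa2 : selfadjoint T2.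
Hypothesis sr2 : spectral_resolution T2 E2.
Variables (V : H1 -> H2).
Hypothesis lV : linear V.
Hypothesis bV : bdd V.
Hypothesis VT : graph_intertwines T1 T2 V.

(* On the range of [E1 t - E1 s] the operator [T1 - s] has norm at most [t - s],
   while [T2 - s] expands the range of [1 - E2 t'] by at least [t' - s]. *)
Lemma band_intertwines s t t' x : s < t -> t < t' -> E1 t x = x -> E1 s x = 0 ->
  E2 t' (V x) = V x.
Proof.
move=> st tt' xt xs; have [K K0 VK] := bV.
pose y k := iter k (fun z => T1 z - s%:C *: z) x.
have ty k : E1 t (y k) = y k /\ E1 s (y k) = 0.
  by elim: k => [//|k [h1 h2]]; exact: (band_shift sa1 sr1).
have dy k : op_dom T1 (y k) by have [h1 h2] := ty k; exact: (dom_band sr1 h1 h2).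
have ny k : nr (y k) <= (t - s) ^+ k * nr x.
  elim: k => [|k IH]; first by rewrite mul1r.
  have [h1 h2] := ty k; apply: le_trans (band_norm sa1 sr1 (ltW st) h1 h2) _.
  by rewrite exprS -mulrA ler_wpM2l// subr_ge0 ltW.
(* [z k] is [(T2 - s)^k] applied to [z 0], so [(t' - s)^k |z 0| <= |z k| <= K (t - s)^k |x|]; as
   [t' > t], this forces [z 0 = 0]. *)
pose z k := V (y k) - E2 t' (V (y k)).
have dVy k : op_dom T2 (V (y k)) by have [] := VT (dy k).
have dz k : op_dom T2 (z k) by exact: (dom_high sa2 sr2).
have zS k : z k.+1 = T2 (z k) - s%:C *: z k.
  rewrite /z (sa_high sa2 sr2)// (VT (dy k)).2 /= (linB lV) (linZ lV).
  rewrite (linB (roi_lin E2 t')) (linZ (roi_lin E2 t')) scalerBr.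
  by rewrite !opprB addrACA [RHS]addrACA [_ - _]addrC.
have nz k : (t' - s) * nr (z k) <= nr (z k.+1).
  have z0 : E2 t' (z k) = 0 by exact: roi_compl_idem.
  have := rip_lower sa2 sr2 (dz k) z0.
  have : rip (z k) (z k.+1) <= nr (z k) * nr (z k.+1) by exact: rip_le.
  rewrite {1}zS ripBr ripZr -nr_sqr.
  have [->|n0] := eqVneq (nr (z k)) 0; first by rewrite mulr0 nr_ge0.
  have np : 0 < nr (z k) by rewrite lt0r n0 nr_ge0.
  by move=> h1 h2; rewrite -(ler_pM2l np); lra.
have nz' k : (t' - s) ^+ k * nr (z 0%N) <= nr (z k).
  elim: k => [|k IH]; first by rewrite mul1r.
  by apply: le_trans (nz k); rewrite exprS -mulrA ler_wpM2l// subr_ge0 ltW// (lt_trans st).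
have t0 : 0 < t - s by rewrite subr_gt0.
have q1 : 1 < (t' - s) / (t - s) by rewrite ltr_pdivlMr// mul1r ltrD2r.
have z0 : nr (z 0%N) = 0.
  apply: (geometric_bound q1 (nr_ge0 _) (b := K * nr x)) => k.
  rewrite exprMn exprVn mulrAC ler_pdivrMr ?exprn_gt0//.
  apply: le_trans (nz' k) _.
  have h : nr (z k) <= nr (V (y k)).
    by rewrite -ler_sqr ?nnegrE ?nr_ge0// (roi_pyth E2 t' (V (y k))) lerDr sqr_ge0.
  apply: le_trans h _; apply: le_trans (VK _) _; rewrite -mulrA ler_wpM2l//.
  by rewrite mulrC.
by have /eqP := nr_eq0 z0; rewrite subr_eq0 eq_sym => /eqP.
Qed.

(** Two limits of [band_intertwines]: [t'] decreases to [t] by right continuity, and the lower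
    cut-off [s] tends to minus infinity. *)
Lemma low_intertwines t x : E1 t x = x -> E2 t (V x) = V x.
Proof.
move=> xt; have [K K0 VK] := bV.
have step s z : s < t -> E1 t z = z -> E1 s z = 0 -> E2 t (V z) = V z.
  move=> st zt zs; apply: eq_of_close => e e0.
  have [t' tt' h] := roi_cvg_right E2 t (V z) e0.
  by rewrite -(band_intertwines st tt' zt zs) (roi_ge E2 _ (ltW tt')) ltW.
apply/eqP; rewrite eq_sym; apply/eqP/eq_of_close => e e0.
have K1 : 0 < K + 1 by rewrite ltr_wpDl.
have [M hM] := roi_cvg_ninfty E1 x (divr_gt0 e0 K1).
pose s := Num.min M t - 1.
have sM : s < M by rewrite /s ltrBlDr (le_lt_trans (_ : _ <= M)) ?ge_min ?lexx// ltrDl.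
have st : s < t by rewrite /s ltrBlDr (le_lt_trans (_ : _ <= t)) ?ge_min ?lexx ?orbT// ltrDl.
have h : E2 t (V (x - E1 s x)) = V (x - E1 s x).
  apply: (step s) => //; last exact: roi_compl_idem.
  by rewrite (linB (roi_lin E1 t)) xt roi_le// ltW.
have -> : V x - E2 t (V x) = V (E1 s x) - E2 t (V (E1 s x)).
  rewrite -{1 2}[x](subrK (E1 s x)) (linD lV) (linD (roi_lin E2 t)) h.
  by rewrite opprD addrACA subrr add0r.
have h2 : nr (V (E1 s x) - E2 t (V (E1 s x))) <= nr (V (E1 s x)).
  by rewrite -ler_sqr ?nnegrE ?nr_ge0// (roi_pyth E2 t (V (E1 s x))) lerDr sqr_ge0.
apply: le_trans h2 _; apply: le_trans (VK _) _.
have := hM s sM; rewrite ltr_pdivlMr// => h3; apply: le_trans (ltW h3).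
by rewrite mulrC ler_wpM2l ?nr_ge0// lerDl.
Qed.

End SpectralIntertwining.

(** [V] maps the range of [E1 t] into that of [E2 t]. The same for [W] says, by adjunction, that [V]
    maps the kernel of [E1 t] into that of [E2 t]. *)
Lemma roi_intertwines (R : realType) (H1 H2 : hilbert R)
    (T1 : unbounded_operator H1) (E1 : resolution_of_identity H1)
    (T2 : unbounded_operator H2) (E2 : resolution_of_identity H2)
    (V : H1 -> H2) (W : H2 -> H1) :
  selfadjoint T1 -> spectral_resolution T1 E1 ->
  selfadjoint T2 -> spectral_resolution T2 E2 ->
  linear V -> bdd V -> adj V W ->
  graph_intertwines T1 T2 V -> graph_intertwines T2 T1 W ->
  forall t x, V (E1 t x) = E2 t (V x).
Proof.
move=> sa1 sr1 sa2 sr2 lV bV aV VT WT t x.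
have lW := adj_linear lV aV.
have bW : bdd W by have [K K0 VK] := bV; exists K => //; exact: adj_bdd aV K0 VK.
rewrite -{2}[x](subrK (E1 t x)) (linD lV) (linD (roi_lin E2 t)).
rewrite (low_intertwines sa1 sr1 sa2 sr2 lV bV VT (x := E1 t x)) ?roi_idem//.
suff -> : E2 t (V (x - E1 t x)) = 0 by rewrite add0r.
apply: rip_inj => y; rewrite rip0r roi_adj aV.
rewrite -(low_intertwines sa2 sr2 sa1 sr1 lW bW WT (t := t)) ?roi_idem//.
by rewrite -roi_adj roi_compl_idem rip0r.
Qed.

(** * Growth of moments *)

Lemma bin_le_exp2 n m : ('C(n, m) <= 2 ^ n)%N.
Proof.
have [mn|nm] := leqP m n; last by rewrite bin_small.
rewrite -[2%N]/(1 + 1)%N Pascal (bigD1 (Ordinal (mn : (m < n.+1)%N)))//=.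
by rewrite !exp1n !muln1 leq_addr.
Qed.

Lemma fact_add_le n m : ((n + m)`! <= 2 ^ (n + m) * (n`! * m`!))%N.
Proof. by rewrite -(bin_fact (leq_addr m n)) addKn leq_mul2r bin_le_exp2 orbT. Qed.

(* [n ^ n <= (n + 1) ... (2 n) = 'C(2 n, n) * n`!]. *)
Lemma expnn_le_fact n : (n ^ n <= 4 ^ n * n`!)%N.
Proof.
apply: (@leq_trans ((n + n) ^_ n)); last first.
  rewrite -bin_ffact leq_mul2r; apply/orP; right.
  by rewrite (leq_trans (bin_le_exp2 _ _))// addnn -mul2n expnM.
rewrite ffact_prod -[X in (n ^ X <= _)%N]card_ord -prod_nat_const leq_prod// => i _.
by rewrite leq_subRL ?leq_add2r ltnW// (leq_trans (ltn_ord i))// leq_addr.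
Qed.

Lemma cabsE (R : realType) (c : R[i]) : (cabs c)%:C = `|c|.
Proof. by rewrite /cabs RRe_real ?ger0_real. Qed.

Lemma cabsM (R : realType) (c d : R[i]) : cabs (c * d) = cabs c * cabs d.
Proof. by have := cabsE (c * d); rewrite normrM -!cabsE -rmorphM => -[]. Qed.

Lemma cabsD (R : realType) (c d : R[i]) : cabs (c + d) <= cabs c + cabs d.
Proof. by rewrite -lecR rmorphD/= !cabsE ler_normD. Qed.

Section Growth.
Variables (R : realType) (A : algType R[i]) (phi : {scalar A}) (S : set A).
Hypothesis hgrowth : growth_condition phi S.

Lemma span_ind (P : A -> Prop) :
  (forall s : seq A, (forall a, a \in s -> S a) -> P (\prod_(a <- s) a)) ->
  (forall (c : R[i]) x y, P x -> P y -> P (c *: x + y)) ->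
  forall a, P a.
Proof.
pose good a := forall P : A -> Prop,
  (forall s : seq A, (forall a, a \in s -> S a) -> P (\prod_(a <- s) a)) ->
  (forall (c : R[i]) x y, P x -> P y -> P (c *: x + y)) -> P a.
suff : forall a, good a by move=> h hw hl a; exact: h.
move=> a; have := growth_generates hgrowth (B := [pred a | `[< good a >]]).
move=> h; apply/asboolP; apply: h; last first.
  move=> b Sb; apply/asboolP => Q hw _; have := hw [:: b].
  by rewrite big_seq1; apply => c; rewrite inE => /eqP ->.
split.
- by apply/asboolP => Q hw _; have := hw [::]; rewrite big_nil; exact.
- move=> c u v /asboolP gu /asboolP gv; apply/asboolP => Q hw hl.
  by apply: (hl c); [exact: (gu Q hw hl)|exact: (gv Q hw hl)].
- move=> u v /asboolP gu /asboolP gv; apply/asboolP => Q hw hl.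
  apply: (gu (fun u => Q (u * v))) => [s hs|c x y]; last by rewrite mulrDl -scalerAl; exact: hl.
  apply: (gv (fun v => Q (_ * v))) => [s' hs'|c x y]; last by rewrite mulrDr -scalerAr; exact: hl.
  by rewrite -big_cat; apply: hw => b; rewrite mem_cat => /orP[/hs|/hs'].
Qed.

(** For words of total length [q] around [a ^+ l], [(q + l)^(q + l) <= 4^(q + l) (q + l)! <= 8^(q +
    l) q! l!]. What comes from [u] and [v] goes into [C], so the rate [8 * w a] survives linear
    combinations. *)
Lemma moment_growth a : S a -> exists2 rho : R, 0 < rho &
  forall u v, exists2 C : R, 0 <= C &
    forall l, cabs (phi (u * a ^+ l * v)) <= C * (l`!%:R * rho ^+ l).
Proof.
move=> Sa; have [w w0 hw] := growth_bound hgrowth.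
exists (8 * w a); first by rewrite mulr_gt0// w0.
have base l : 0 <= l`!%:R * (8 * w a) ^+ l by rewrite mulr_ge0// exprn_ge0// mulr_ge0// ltW// w0.
apply: span_ind => [s hs|c x y hx hy v].
  apply: span_ind => [s' hs'|c x y [C C0 hC] [D D0 hD]]; last first.
    exists (cabs c * C + D); first by rewrite addr_ge0// mulr_ge0// cabs_ge0.
    move=> l; rewrite mulrDr -scalerAr linearD linearZ/=.
    apply: le_trans (cabsD _ _) _; rewrite cabsM mulrDl lerD// -mulrA.
    by rewrite ler_wpM2l ?cabs_ge0.
  set q := (size s + size s')%N.
  pose W : R := (\prod_(b <- s) w b) * (\prod_(b <- s') w b).
  have W0 : 0 <= W.
    rewrite mulr_ge0//; rewrite big_seq_cond prodr_ge0// => b; rewrite andbT.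
      by move/hs/w0/ltW.
    by move/hs'/w0/ltW.
  exists ((8 ^ q * q`!)%:R * W); first by rewrite mulr_ge0.
  move=> l; have /hw : forall b, b \in s ++ nseq l a ++ s' -> S b.
    move=> b; rewrite !mem_cat => /or3P[/hs|/nseqP[->]|/hs']//.
  rewrite !big_cat/= !big_nseq !iter_mulr !mulr1 -cabsE lecR mulrA => h.
  apply: le_trans h _; rewrite !size_cat size_nseq addnCA -/q addnC.
  have -> : \prod_(b <- s) w b * (w a ^+ l * \prod_(b <- s') w b) = w a ^+ l * W by rewrite /W; ring.
  have -> : (8 ^ q * q`!)%:R * W * (l`!%:R * (8 * w a) ^+ l) =
     (8 ^ (q + l) * (q`! * l`!))%:R * (w a ^+ l * W).
    by rewrite exprMn !natrM expnD !natrM !natrX; ring.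
  apply: ler_wpM2r; first by rewrite mulr_ge0// exprn_ge0// ltW// w0.
  rewrite ler_nat.
  apply: leq_trans (expnn_le_fact _) _.
  by rewrite -[8%N]/(4 * 2)%N expnMn -mulnA leq_mul2l fact_add_le orbT.
have [C C0 hC] := hx v; have [D D0 hD] := hy v.
exists (cabs c * C + D); first by rewrite addr_ge0// mulr_ge0// cabs_ge0.
move=> l; have -> : (c *: x + y) * a ^+ l * v = c *: (x * a ^+ l * v) + y * a ^+ l * v.
  by rewrite !mulrDl -!scalerAl.
rewrite linearD linearZ/=; apply: le_trans (cabsD _ _) _; rewrite cabsM mulrDl lerD//.
by rewrite -[leRHS]mulrA ler_wpM2l ?cabs_ge0.
Qed.

End Growth.

(** * Representations *)

Lemma ipZil (R : realType) (H : hilbert R) (x y : H) : ip ('i *: x) y = - 'i * ip x y.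
Proof.
by rewrite ipZl; congr (_ * _); apply/eqP; rewrite eq_complex /= oppr0 !eqxx.
Qed.

(** Expanding at [b + c] makes the form antisymmetric; at ['i *: c] the two sides then pick up
    opposite factors, so it vanishes. *)
Lemma polarization (R : realType) (H : hilbert R) (A : lmodType R[i]) (f : {linear A -> H})
    (g : A -> H) :
  (forall b c, g (b + c) = g b + g c) -> (forall b, g ('i *: b) = 'i *: g b) ->
  (forall b, ip (f b) (g b) = 0) -> forall b c, ip (f b) (g c) = 0.
Proof.
move=> gD gZ h.
have h2 b c : ip (f b) (g c) = - ip (f c) (g b).
  have := h (b + c); rewrite linearD gD !ipDl !ipDr !h add0r addr0 => /eqP.
  by rewrite addr_eq0 => /eqP.
move=> b c; have := h2 b ('i *: c).
rewrite gZ linearZ/= ipZr ipZil (h2 c b) mulNr mulrN opprK => /eqP.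
rewrite -addr_eq0 -mulr2n mulrn_eq0 mulf_eq0 /= => /orP[|/eqP//].
by rewrite eq_complex/= oner_eq0 andbF.
Qed.

Section Representation.
Variables (R : realType) (A : algType R[i]) (star : A -> A) (phi : {scalar A}) (S : set A).
Hypothesis hA : star_probability_space star phi.
Hypothesis hS : forall a, S a -> star a = a.
Hypothesis hgrowth : growth_condition phi S.
Variable rho : representation star phi S.
Let alpha := rep_map rho.

Lemma rep_sym a b c : S a -> ip (alpha (a * b)) (alpha c) = ip (alpha b) (alpha (a * c)).
Proof. by move=> Sa; rewrite -!rep_phi (star_mul (sps_star hA)) (hS Sa) mulrA. Qed.

(** Symmetry makes [(alpha (a * b), alpha b)] real. Hence cross terms vanish in the norms of
    [alpha (a * b)] plus an imaginary multiple of [alpha b]. *)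
Lemma rep_skew a b : S a -> rip (alpha (a * b)) ('i *: alpha b) = 0.
Proof.
move=> Sa; suff : rip (alpha (a * b)) ('i *: alpha b) = - rip (alpha (a * b)) ('i *: alpha b).
  by lra.
have -> : 'i *: alpha b = alpha ('i *: b) by rewrite linearZ.
rewrite {1}/rip rep_sym// -scalerAr linearZ/= -/(rip _ _) ripi ripC.
by rewrite linearZ.
Qed.

Lemma rep_in_dom a b : S a -> op_dom (rep_op rho a) (alpha b).
Proof. by move=> Sa; have [] := @rep_dom _ _ _ _ _ rho a 1%N b Sa. Qed.

(* The moments give [(alpha c, a alpha b) = (alpha c, alpha (a * b))] by
   polarization; the second moment excludes a component off the range of [alpha]. *)
Lemma rep_mul a b : S a -> rep_op rho a (alpha b) = alpha (a * b).
Proof.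
move=> Sa; have saT := rep_op_sa rho (or_introl Sa); have srT := rep_resP rho Sa.
have dT c := rep_in_dom c Sa.
pose g c := rep_op rho a (alpha c) - alpha (a * c).
have g0 c : ip (alpha c) (g c) = 0.
  have [_ /= m1] := @rep_moment _ _ _ _ _ rho a c 1%N Sa.
  rewrite /g ipBr (sr_val srT)//; apply/eqP; rewrite subr_eq0; apply/eqP.
  by rewrite expr1 in m1; rewrite -m1; congr (_%:C); apply: eq_Rintegral => t _; rewrite expr1.
have go := polarization _ _ g0.
have {go} go : forall c d, ip (alpha c) (g d) = 0.
  apply: go => [c d|c]; rewrite /g linearD//.
    rewrite mulrDr linearD (sa_D saT)//.
    by rewrite opprD addrACA.
  by rewrite -scalerAr !linearZ/= (sa_Z saT)// scalerBr.
have : rip (rep_op rho a (alpha b)) (rep_op rho a (alpha b)) <= rip (alpha (a * b)) (alpha (a * b)).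
  apply: le_trans (sa_norm_le saT srT (dT b)) _.
  have [_ /= m2] := @rep_moment _ _ _ _ _ rho a b 2%N Sa.
  by rewrite /rip rep_sym// mulrA -expr2 -m2.
have -> : rep_op rho a (alpha b) = g b + alpha (a * b) by rewrite /g subrK.
rewrite -nr_sqr nr_pythagoras ?nr_sqr; last by rewrite ripC /rip go.
rewrite gerDl => h; have : rip (g b) (g b) = 0 by apply/eqP; rewrite eq_le h rip_ge0.
by move/rip_eq0 => ->; rewrite add0r.
Qed.

(* Euler scheme for [exp (- sigma t 'i a) b] with time step [eps]. Along it the
   norm is almost conserved, while a vector orthogonal to the range of
   [a - sigma 'i] sees growth by a factor [1 + eps] at each step. *)
Section EulerScheme.
Variables (a : A) (sigma : R) (eps : R) (b : A).
Hypothesis Sa : S a.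
Hypothesis sigma2 : sigma ^+ 2 = 1.
Hypothesis eps0 : 0 < eps.
Let c : R[i] := - ((sigma * eps)%:C * 'i).
Definition euler k := iter k (fun y => y + c *: (a * y)) b.

Let nc x : nr (c *: x : rep_space rho) = eps * nr x.
Proof.
have s1 : `|sigma| = 1.
  by apply/eqP; rewrite -sqrp_eq1// -normrX sigma2 normr1.
by rewrite /c scaleNr nrN -scalerA nrZr nrZi normrM s1 mul1r gtr0_norm.
Qed.

Lemma euler_norm k :
  nr (alpha (euler k.+1)) ^+ 2 =
  nr (alpha (euler k)) ^+ 2 + eps ^+ 2 * nr (alpha (a * euler k)) ^+ 2.
Proof.
rewrite /= -/(euler k); move: (euler k) => y; rewrite linearD linearZ/= addrC.
rewrite nr_pythagoras ?nc ?exprMn//.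
have r0 : rip ('i *: alpha y) (alpha (a * y)) = 0 by rewrite ripC rep_skew.
have r1 : rip ('i *: alpha (a * y)) (alpha y) = 0.
  by rewrite ripC ripi r0 oppr0.
by rewrite /c scaleNr -scalerA ripNl ripZl r1 mulr0 oppr0.
Qed.

(* The right-hand side is the [m]-th derivative of [C / (1 - kap * t)] at
   [t = k * eps]; the induction step is the convexity of these derivatives. *)
Lemma euler_bound (C kap : R) k : 0 <= C -> 0 < kap ->
  (forall m, nr (alpha (a ^+ m * b)) <= C * (m`!%:R * kap ^+ m)) ->
  kap * (k%:R * eps) < 1 ->
  forall m, nr (alpha (a ^+ m * euler k)) <=
    C * (m`!%:R * kap ^+ m) / (1 - kap * (k%:R * eps)) ^+ m.+1.
Proof.
move=> C0 kap0 hb; elim: k => [|k IH] hk m.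
  by rewrite mul0r mulr0 subr0 expr1n divr1.
set u := 1 - kap * (k%:R * eps); set d := kap * eps.
have d0 : 0 < d by rewrite mulr_gt0.
have uE : 1 - kap * (k.+1%:R * eps) = u - d by rewrite -natr1 /u /d; ring.
have ud : 0 < u - d by rewrite -uE subr_gt0.
have u0 : 0 < u by rewrite (lt_trans ud)// gtrBl.
have {}IH := IH (_ : _ < 1); rewrite uE.
have hk' : kap * (k%:R * eps) < 1 by rewrite -subr_gt0.
rewrite /= -/(euler k).
have -> : a ^+ m * (euler k + c *: (a * euler k)) = a ^+ m * euler k + c *: (a ^+ m.+1 * euler k).
  by rewrite mulrDr -scalerAr mulrA -exprSr.
rewrite linearD linearZ/=; apply: le_trans (nrD _ _) _; rewrite nc.
have := IH hk' m; have := IH hk' m.+1; rewrite -/u => h1 h2.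
apply: le_trans (lerD h2 (ler_wpM2l (ltW eps0) h1)) _.
have -> : C * (m`!%:R * kap ^+ m) / u ^+ m.+1 + eps * (C * (m.+1`!%:R * kap ^+ m.+1) / u ^+ m.+2)
   = C * (m`!%:R * kap ^+ m) * ((1 + m.+1%:R * (d / u)) / u ^+ m.+1).
  rewrite factS natrM !exprS /d; field.
  by rewrite expf_neq0 gt_eqF.
apply: ler_wpM2l; first by rewrite !mulr_ge0// exprn_ge0// ltW.
rewrite ler_pdivrMr ?exprn_gt0// [leRHS]mulrC -exprVn -exprMn.
(* It remains to compare bases: [(1 + d / u) (u - d) = u - d^2 / u <= u]. *)
apply: le_trans (bernoulli_ineq m.+1 _) _; first by rewrite divr_ge0 ?ltW.
apply: lerXn2r; rewrite ?nnegrE; first by rewrite addr_ge0// divr_ge0 ?ltW.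
  by rewrite divr_ge0 ?ltW.
rewrite ler_pdivlMr//.
have -> : (1 + d / u) * (u - d) = u - d * (d / u) by field; rewrite gt_eqF.
by rewrite gerBl mulr_ge0 ?divr_ge0 ?ltW.
Qed.

(** The sign in [c] is such that [c * sigma * 'i = eps], so the deficiency equation turns each Euler
    step into multiplication by [1 + eps]. *)
Lemma euler_orth z k :
  (forall y, ip (alpha (a * y) - (sigma%:C * 'i) *: alpha y) z = 0) ->
  rip (alpha (euler k)) z = (1 + eps) ^+ k * rip (alpha b) z.
Proof.
move=> hz; elim: k => [|k IH]; first by rewrite mul1r.
rewrite exprS -mulrA -IH /= -/(euler k) linearD linearZ/=.
have := hz (euler k); move: (euler k) => y /eqP.
rewrite ipBl subr_eq0 => /eqP h.
rewrite /rip ipDl ipZl h ipZl mulrA.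
have -> : c^* * (sigma%:C * 'i)^* = eps%:C.
  rewrite -rmorphM /c mulNr mulrACA -rmorphM/=.
  rewrite -expr2 sqrCi mulrN1 opprK mulrAC -expr2 sigma2 mul1r.
  by rewrite conj_Creal ?complex_real.
by rewrite raddfD/= mulrDl mul1r; congr (_ + _); case: (ip _ z) => p q /=; rewrite mul0r subr0.
Qed.

End EulerScheme.

(** The squared norm is the moment of order [2 m], and [(2 m)! <= 4^m (m!)^2]; taking the root gives
    the rate [2 * r] and the constant [Num.sqrt C]. *)
Lemma analytic_bound a : S a -> exists2 kap : R, 0 < kap &
  forall b, exists2 C : R, 0 <= C &
    forall m, nr (alpha (a ^+ m * b)) <= C * (m`!%:R * kap ^+ m).
Proof.
move=> Sa; have [r r0 hr] := moment_growth hgrowth Sa.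
exists (2 * r); first exact: mulr_gt0.
move=> b; have [C C0 hC] := hr (star b) b; exists (Num.sqrt C); first exact: sqrtr_ge0.
move=> m; rewrite -ler_sqr ?nnegrE ?nr_ge0//; last first.
  by rewrite !mulr_ge0 ?sqrtr_ge0 ?exprn_ge0// mulr_ge0// ltW.
have mE : ip (alpha (a ^+ m * b)) (alpha (a ^+ m * b)) = phi (star b * a ^+ (m + m) * b).
  have h : forall k c, ip (alpha (a ^+ k * b)) (alpha c) = ip (alpha b) (alpha (a ^+ k * c)).
    elim=> [|k IH] d; first by rewrite !mul1r.
    by rewrite exprS -mulrA rep_sym// IH mulrA -exprSr -exprS.
  by rewrite h mulrA -exprD -rep_phi mulrA.
rewrite nr_sqr /rip mE; apply: le_trans (_ : cabs (phi (star b * a ^+ (m + m) * b)) <= _).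
  rewrite -mE ip_self -lecR cabsE ger0_norm//.
  by rewrite lecR rip_ge0.
apply: le_trans (hC _) _; rewrite exprMn sqr_sqrtr// ler_wpM2l//.
rewrite !exprMn -!exprM muln2 -addnn mulrA; apply: ler_wpM2r; first by rewrite exprn_ge0// ltW.
rewrite -natrX -natrX -natrM ler_nat mulnC.
by apply: leq_trans (fact_add_le m m) _; rewrite expnS expn1.
Qed.

(** After [n] Euler steps of size [r / n], the pairing with [z] has grown by at least [1 + r], while
    the squared norm has grown by at most [(r B)^2 / n]. As [n] grows this yields [key], with [r]
    independent of [b]; taking [alpha b] close to a nonzero [z] contradicts it. *)
Lemma deficiency_trivial a (sigma : R) z : S a -> sigma ^+ 2 = 1 ->
  limpt [set alpha b | b in setT] z ->
  (forall b, ip (alpha (a * b) - (sigma%:C * 'i) *: alpha b) z = 0) -> z = 0.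
Proof.
move=> Sa s2 lz hz; have [kap kap0 hk] := analytic_bound Sa.
(* Half the radius of analyticity: up to time [r] the denominator in [euler_bound] stays at least
   [1 / 2]. *)
pose r := (2 * kap)^-1; have r0 : 0 < r by rewrite invr_gt0 mulr_gt0.
have key b : (1 + r) * `|rip (alpha b) z| <= nr (alpha b) * nr z.
  have [C C0 hC] := hk b.
  (* [euler_bound] at [m = 1] with that denominator. *)
  pose B := C * kap / (1 / 2) ^+ 2.
  rewrite -ler_sqr ?nnegrE ?mulr_ge0 ?nr_ge0 ?addr_ge0 ?(ltW r0)//.
  apply/ler_addgt0Pr => e e0.
  pose D := (r * B) ^+ 2 * nr z ^+ 2.
  have DD : 0 <= D by rewrite mulr_ge0 ?sqr_ge0.
  have D0 : 0 <= D / e by rewrite divr_ge0// ltW.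
  have := archi_boundP D0; set N := Num.bound _ => hN.
  pose n := N.+1; pose eps := r / n%:R.
  have n0 : 0 < n%:R :> R by rewrite ltr0n.
  have e_gt0 : 0 < eps by rewrite divr_gt0.
  have ne : n%:R * eps = r by rewrite /eps mulrCA divff ?mulr1// gt_eqF.
  have nB k : (k <= n)%N -> nr (alpha (a * euler a sigma eps b k)) <= B.
    move=> kn.
    have kk : kap * (k%:R * eps) <= 1 / 2.
      have : k%:R * eps <= r by rewrite -ne ler_wpM2r ?ler_nat// ltW.
      move/(ler_wpM2l (ltW kap0)) => h; apply: le_trans h _.
      by rewrite /r invfM mulrCA divff ?mulr1 ?div1r// gt_eqF.
    have := euler_bound s2 e_gt0 C0 kap0 hC (k := k) _ 1%N.
    rewrite -[1`!]/1%N !expr1 mul1r => h; apply: le_trans (h _) _; first by lra.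
    apply: ler_wpM2l; first by rewrite mulr_ge0// ltW.
    have hh : 1 / 2 <= 1 - kap * (k%:R * eps) by lra.
    rewrite lef_pV2 ?posrE ?exprn_gt0//; first by rewrite ler_sqr ?nnegrE//; lra.
    by lra.
  have nE k : (k <= n)%N -> nr (alpha (euler a sigma eps b k)) ^+ 2 <=
      nr (alpha b) ^+ 2 + k%:R * (eps * B) ^+ 2.
    elim: k => [|k IH] kn; first by rewrite mul0r addr0.
    rewrite euler_norm// -natr1 mulrDl mul1r addrA lerD ?IH 1?ltnW//.
    rewrite [leRHS]exprMn; apply: ler_wpM2l; first exact: sqr_ge0.
    by rewrite ler_sqr ?nnegrE ?nr_ge0 ?nB ?(le_trans (nr_ge0 _) (nB 0%N _))// ltnW.
  have orth := euler_orth eps b s2 n hz.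
  have h1 : (1 + r) * `|rip (alpha b) z| <= nr (alpha (euler a sigma eps b n)) * nr z.
    apply: le_trans (rip_cs _ _); rewrite orth normrM; apply: ler_wpM2r => //.
    rewrite ger0_norm ?exprn_ge0 ?addr_ge0 ?(ltW e_gt0)//.
    by have := bernoulli_ineq n (ltW e_gt0); rewrite ne.
  have h2 : ((1 + r) * `|rip (alpha b) z|) ^+ 2 <=
      nr (alpha (euler a sigma eps b n)) ^+ 2 * nr z ^+ 2.
    rewrite -exprMn ler_sqr ?nnegrE// mulr_ge0 ?nr_ge0//.
    by rewrite addr_ge0// ltW.
  apply: le_trans h2 _; apply: le_trans (ler_wpM2r (sqr_ge0 _) (nE n (leqnn _))) _.
  rewrite mulrDl [(nr _ * nr _) ^+ 2]exprMn lerD2l.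
  have -> : n%:R * (eps * B) ^+ 2 * nr z ^+ 2 = D / n%:R.
    by rewrite /D /eps; field; rewrite gt_eqF.
  rewrite ler_pdivrMr// mulrC -ler_pdivrMr// (le_trans (ltW hN))// ler_nat.
  exact: leqnSn.
have [//|z0] := eqVneq z 0.
have zp : 0 < nr z by rewrite lt0r nr_ge0 andbT; apply: contra_neq z0 => /nr_eq0.
have r2 : 0 < 2 + r by rewrite addr_gt0.
(* With [d] the distance from [z] to [alpha b], [key] is violated once
   [(1 + r) (|z| - d) > |z| + d], that is, [d (2 + r) < r |z|]. *)
have [|_ [b _ <-] hb] := lz (r * nr z / (2 * (2 + r))).
  by rewrite divr_gt0// mulr_gt0.
set d := nr (z - alpha b) in hb.
have hd : d * (2 + r) < r * nr z.
  move: hb; rewrite ltr_pdivlMr ?mulr_gt0// mulrCA.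
  by have : 0 <= d * (2 + r) by [rewrite mulr_ge0 ?nr_ge0// ltW]; lra.
have h1 : nr z ^+ 2 - d * nr z <= `|rip (alpha b) z|.
  have -> : rip (alpha b) z = nr z ^+ 2 - rip (z - alpha b) z by rewrite ripBl nr_sqr; ring.
  by apply: le_trans (ler_norm _); rewrite lerB// rip_le.
have h2 : nr (alpha b) <= nr z + d.
  have -> : alpha b = z - (z - alpha b) by rewrite opprB addrC subrK.
  by rewrite (le_trans (nrD _ _))// nrN.
have h3 := key b; exfalso.
have h4 := ler_wpM2r (nr_ge0 z) h2.
have h5 : (1 + r) * (nr z ^+ 2 - d * nr z) <= (1 + r) * `|rip (alpha b) z|.
  by rewrite ler_wpM2l// addr_ge0// ltW.
have h6 : d * (2 + r) * nr z < r * nr z * nr z by rewrite ltr_pM2r.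
by move: h3 h4 h5 h6; move: (nr (alpha b)) (`|_|) => p q; clear; lra.
Qed.

End Representation.

(** * The partial isometry between two representations *)

Record gram_pair (R : realType) (A : lmodType R[i]) (H1 H2 : hilbert R)
    (f1 : A -> H1) (f2 : A -> H2) (V : H1 -> H2) (W : H2 -> H1) : Prop := {
  gp_lin : linear V;
  gp_norm : forall x, nr (V x) <= nr x;
  gp_adj : adj V W;
  gp_val : forall b, V (f1 b) = f2 b;
  gp_val_adj : forall b, W (f2 b) = f1 b;
  gp_orth : forall x, (forall b, ip (f1 b) x = 0) -> V x = 0;
  gp_orth_adj : forall y, (forall b, ip (f2 b) y = 0) -> W y = 0 }.

Lemma gram_pair_sym (R : realType) (A : lmodType R[i]) (H1 H2 : hilbert R)
    (f1 : A -> H1) (f2 : A -> H2) (V : H1 -> H2) (W : H2 -> H1) :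
  gram_pair f1 f2 V W -> gram_pair f2 f1 W V.
Proof.
case=> lV nV aV h1 h2 o1 o2; split => //.
- exact: adj_linear lV aV.
- move=> x; rewrite -[nr x]mul1r; apply: (adj_bdd aV) => // y.
  by rewrite mul1r.
- exact: adjC.
Qed.

Section GramPair.
Variables (R : realType) (A : lmodType R[i]) (H1 H2 : hilbert R).
Variables (f1 : {linear A -> H1}) (f2 : {linear A -> H2}).

Lemma range_linspace (H : hilbert R) (f : {linear A -> H}) : linspace (range f).
Proof.
split; first by exists 0 => //; rewrite linear0.
by move=> c _ _ [x _ <-] [y _ <-]; exists (c *: x + y) => //; rewrite linearP.
Qed.

Lemma range_split (H : hilbert R) (f : {linear A -> H}) x :
  exists2 p, limpt (range f) p & forall b, ip (f b) (x - p) = 0.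
Proof.
have [p lp hp] := projection_theorem x (range_linspace f).
by exists p => // b; apply: hp; exists b.
Qed.

(** [G] sends [f1 b + l] to [f2 b] for [l] orthogonal to the range of [f1]. Such sums are dense, and
    by Pythagoras together with the equality of Gram matrices the map is contractive. *)
Lemma gram_pair_exists : (forall b c, ip (f1 b) (f1 c) = ip (f2 b) (f2 c)) ->
  exists V W, gram_pair f1 f2 V W.
Proof.
move=> gram.
pose G u v := exists b l, [/\ forall c, ip (f1 c) l = 0, u = f1 b + l & v = f2 b].
have Glin (c : R[i]) u v u' v' : G u v -> G u' v' -> G (c *: u + u') (c *: v + v').
  move=> [b [l [hl -> ->]]] [b' [l' [hl' -> ->]]]; exists (c *: b + b'), (c *: l + l'); split.
  - by move=> d; rewrite ipDr ipZr hl hl' mulr0 addr0.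
  - by rewrite linearP scalerDr addrACA.
  - by rewrite linearP.
have Gb u v : G u v -> nr v <= 1 * nr u.
  move=> [b [l [hl -> ->]]]; rewrite mul1r.
  rewrite -ler_sqr ?nnegrE ?nr_ge0// addrC nr_pythagoras; last by rewrite ripC /rip hl.
  by rewrite [in leLHS]nr_sqr /rip -gram -/(rip _ _) -nr_sqr lerDl sqr_ge0.
pose D := [set u | exists v, G u v].
have Dd x : limpt D x.
  move=> e e0; have [p lp hp] := range_split f1 x.
  have [_ [b _ <-] pb] := lp e e0; exists (f1 b + (x - p)).
    by exists (f2 b), b, (x - p); split.
  by rewrite opprD opprB addrCA [x + _]addrC subrK addrC.
have Gd x e : 0 < e -> exists u v, G u v /\ nr (x - u) < e.
  by move=> e0; have [u [v Guv] h] := Dd x e e0; exists u, v.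
have [V [lV nV VG]] := bounded_extension ler01 Glin Gb Gd.
have bV : bdd V by exists 1.
have [W aV] := bdd_adj_exists lV bV.
have sD : linspace D.
  split; first by exists (f2 0), 0, 0; split => [c||//]; rewrite ?ip0r// linear0 addr0.
  by move=> c u u' [v Gv] [v' Gv']; exists (c *: v + v'); exact: Glin.
have Vval b : V (f1 b) = f2 b.
  by apply: VG; exists b, 0; split => [c||//]; rewrite ?ip0r ?addr0.
have zeroD u : (forall d, D d -> rip d u = 0) -> u = 0.
  by move=> h; apply/ip_eq0/(ip_limpt0 (rip_orth sD h)).
exists V, W; split => //.
- by move=> x; have := nV x; rewrite mul1r.
- move=> b; apply/eqP; rewrite -subr_eq0; apply/eqP/zeroD => _ [_ [c [l [hl -> _]]]].
  rewrite ripBr (adjC aV) (VG _ (f2 c)); last by exists c, l.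
  by rewrite ripDl /rip gram (ip_conj (f1 b)) hl conjc0 addr0 subrr.
- by move=> x hx; apply: VG; exists 0, x; rewrite !linear0 add0r.
- move=> y hy; apply: zeroD => _ [_ [c [l [hl -> _]]]].
  by rewrite (adjC aV) (VG _ (f2 c)) ?/rip ?hy//; exists c, l.
Qed.

End GramPair.

Section RepresentationPair.
Variables (R : realType) (A : algType R[i]) (star : A -> A) (phi : {scalar A}) (S : set A).
Hypothesis hA : star_probability_space star phi.
Hypothesis hS : forall a, S a -> star a = a.
Hypothesis hgrowth : growth_condition phi S.

(** If [q] is the projection of [p] onto the closure of the shifted range, then [p - q] still lies
    in the cyclic space and solves the deficiency equation, so it is zero. *)
Lemma shift_dense (rho : representation star phi S) a (sigma : R) p : S a -> sigma ^+ 2 = 1 ->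
  limpt (range (rep_map rho)) p ->
  limpt [set rep_map rho (a * b) - (sigma%:C * 'i) *: rep_map rho b | b in setT] p.
Proof.
move=> Sa s2 lp; set D := (X in limpt X).
have sD : linspace D.
  split; first by exists 0 => //; rewrite mulr0 linear0 scaler0 subr0.
  move=> c _ _ [x _ <-] [y _ <-]; exists (c *: x + y) => //.
  by rewrite mulrDr -scalerAr !linearP/= addrACA -scalerDr.
have [q lq hq] := projection_theorem p sD.
suff -> : p = q by [].
apply/eqP; rewrite -subr_eq0; apply/eqP.
apply: (deficiency_trivial hA hS hgrowth Sa s2) => [|b]; last by apply: hq; exists b.
apply: (linspaceB (limpt_linspace (range_linspace _))) => // e e0.
have [_ [b _ <-] h] := lq e e0.
by exists (rep_map rho (a * b - (sigma%:C * 'i) *: b)); [exists (a * b - (sigma%:C * 'i) *: b)|rewrite linearB linearZ].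
Qed.

(** For [x] in the domain, [p] is the part of [(T1 - i) x] in the cyclic space. Some [b] brings
    [(a - i) b] close to [p], and then [f2 b] and [f2 (a * b)] approximate [V x] and [V (T1 x)]. *)
Lemma graph_intertwines_pair (rho1 rho2 : representation star phi S) V W a :
  gram_pair (rep_map rho1) (rep_map rho2) V W -> S a ->
  graph_intertwines (rep_op rho1 a) (rep_op rho2 a) V.
Proof.
move=> gp Sa x dx; have [lV nV aV val valW orth orthW] := gp.
have sa1 := rep_op_sa rho1 (or_introl Sa); have sa2 := rep_op_sa rho2 (or_introl Sa).
have [lW nW _ _ _ _ _] := gram_pair_sym gp.
set T1 := rep_op rho1 a in sa1 *; set T2 := rep_op rho2 a in sa2 *.
set f1 := rep_map rho1 in gp val valW orth; set f2 := rep_map rho2 in gp val valW orthW.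
have T1f b : T1 (f1 b) = f1 (a * b) by exact: rep_mul.
have T2f b : T2 (f2 b) = f2 (a * b) by exact: rep_mul.
have df1 b : op_dom T1 (f1 b) by exact: rep_in_dom.
have df2 b : op_dom T2 (f2 b) by exact: rep_in_dom.
pose h := T1 x - 'i *: x.
have [p lp hp] := range_split f1 h.
have Vhp : V (h - p) = 0 by apply: orth.
have approx e : 0 < e -> exists b,
    nr (V x - f2 b) <= e /\ nr (V (T1 x) - f2 (a * b)) <= 2 * e.
  move=> e0; have [_ [b _ <-] pb] := shift_dense Sa (expr1n _ 2) lp e0.
  exists b; rewrite -/f1 rmorph1 mul1r in pb; set d := f1 (a * b) - 'i *: f1 b in pb.
  pose w := f1 b - x.
  (* Moving [T1 + i] across gives the pairing of [f1 c] with [(T1 - i) w = d - h], and [h] may be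
     replaced by [p]. By [rep_skew], [f1 c] is no longer than the vector tested against. *)
  have gw c : rip (f1 (a * c) + 'i *: f1 c) w <= e * nr (f1 (a * c) + 'i *: f1 c).
    have -> : rip (f1 (a * c) + 'i *: f1 c) w = - rip (f1 c) (p - d).
      have dw : op_dom T1 w by exact: (linspaceB (dom_linspace sa1)).
      have Tw : T1 w - 'i *: w = d - h.
        rewrite /w (sa_B sa1)// T1f scalerBr /d /h !opprB addrACA [RHS]addrACA.
        by rewrite [- T1 x + _]addrC.
      have ph : rip (f1 c) (h - p) = 0 by rewrite /rip hp.
      have -> : rip (f1 (a * c) + 'i *: f1 c) w = rip (f1 c) (T1 w - 'i *: w).
        by rewrite ripDl (ripBr (f1 c) (T1 w)) (sa_sym sa1 dw (df1 c)) T1f ripi opprK.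
      by rewrite Tw; clearbody d h; move: ph; rewrite !ripBr; lra.
    have le1 : nr (f1 c) <= nr (f1 (a * c) + 'i *: f1 c).
      rewrite -ler_sqr ?nnegrE ?nr_ge0// nr_pythagoras; last exact: rep_skew.
      by rewrite nrZi lerDl sqr_ge0.
    rewrite -ripNr (le_trans (rip_le _ _))// nrN mulrC ler_pM ?nr_ge0//.
    exact: ltW.
  (* The vectors tested in [gw] are dense in the cyclic space, by [shift_dense] with [sigma = -1];
     so the projection of [w] onto that space has norm at most [e]. *)
  have gw_lim g : limpt (range f1) g -> rip g w <= e * nr g.
    move=> lg; have s2 : (-1 : R) ^+ 2 = 1 by rewrite sqrrN expr1n.
    have lgD := shift_dense Sa s2 lg; apply/ler_addgt0Pr => t t0.
    have k0 : 0 < e + nr w + 1 by have := nr_ge0 w; lra.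
    have [_ [c _ <-]] := lgD _ (divr_gt0 t0 k0).
    have -> : rep_map rho1 (a * c) - ((-1)%:C * 'i) *: rep_map rho1 c = f1 (a * c) + 'i *: f1 c.
      by rewrite rmorphN rmorph1 mulN1r scaleNr opprK.
    have := gw c; set u := f1 (a * c) + _ => hu; rewrite ltr_pdivlMr// => hgu.
    have -> : rip g w = rip u w + rip (g - u) w by rewrite -ripDl addrC subrK.
    have h1 : nr u <= nr g + nr (g - u).
      by rewrite -{1}[u](subKr g) (le_trans (nrD _ _))// nrN.
    have h2 := ler_wpM2l (ltW e0) h1; have h3 := rip_le (g - u) w.
    have := nr_ge0 (g - u); clearbody u; lra.
  have [pw lpw hpw] := range_split f1 w.
  have Vw : nr (V w) <= e.
    have -> : V w = V pw.
      by apply/eqP; rewrite -subr_eq0 -(linB lV) orth.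
    apply: le_trans (nV _) _.
    have [->|n0] := eqVneq (nr pw) 0; first exact: ltW.
    have np : 0 < nr pw by rewrite lt0r n0 nr_ge0.
    rewrite -(ler_pM2r np) -expr2 nr_sqr.
    have -> : rip pw pw = rip pw w.
      apply/eqP; rewrite eq_sym -subr_eq0 -ripBr /rip (ip_limpt0 _ lpw)//.
      by move=> _ [c _ <-]; exact: hpw.
    exact: gw_lim.
  have VwE : V w = f2 b - V x by rewrite (linB lV) val.
  split; first by rewrite nrB -VwE.
  have -> : V (T1 x) - f2 (a * b) = V (p - d) - 'i *: V w.
    have -> : V (T1 x) - f2 (a * b) = V (h - p) + V (p - d) - 'i *: V w.
      rewrite -val -(linZ lV) -(linB lV) -(linD lV) -(linB lV); congr V.
      by rewrite subrKA /d /h /w scalerBr !opprB addrAC !subrKA.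
    by rewrite Vhp add0r.
  apply: le_trans (nrD _ _) _; rewrite nrN nrZi mulr2n mulrDl mul1r.
  by rewrite lerD// (le_trans (nV _))// ltW.
(* The graph of [T2] is closed: pairing the approximations with [T2 y] and [y] passes to the
   limit. *)
apply: (sa_weak sa2) => y dy.
apply/eqP; rewrite -subr_eq0 -normr_le0; apply/ler_addgt0Pr => t t0; rewrite add0r.
have k0 : 0 < nr (T2 y) + 2 * nr y + 1.
  by rewrite ltr_wpDl// addr_ge0 ?mulr_ge0 ?nr_ge0.
have [b [b1 b2]] := approx _ (divr_gt0 t0 k0); set e := t / _ in b1 b2.
have -> : rip (V x) (T2 y) - rip (V (T1 x)) y =
    rip (V x - f2 b) (T2 y) - rip (V (T1 x) - f2 (a * b)) y.
  by rewrite !ripBl (sa_sym sa2 dy (df2 b)) T2f; ring.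
have te : t = e * (nr (T2 y) + 2 * nr y + 1) by rewrite /e divfK// gt_eqF.
have e0 : 0 <= e by rewrite divr_ge0 ?ltW.
apply: le_trans (ler_normB _ _) _.
have h1 := le_trans (rip_cs (V x - f2 b) (T2 y)) (ler_wpM2r (nr_ge0 _) b1).
have h2 := le_trans (rip_cs (V (T1 x) - f2 (a * b)) y) (ler_wpM2r (nr_ge0 _) b2).
apply: le_trans (lerD h1 h2) _; rewrite te; clearbody e; clear -e0; lra.
Qed.

End RepresentationPair.

(** * Isomorphism of the generated von Neumann algebras *)

Theorem theorem5p3 (R : realType) (A : algType R[i]) (star : A -> A)
    (phi : {scalar A}) (S : set A)
    (hA : star_probability_space star phi)
    (hS : forall a, S a -> star a = a)
    (hgrowth : growth_condition phi S)
    (rho1 rho2 : representation star phi S)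
    (hfaithful1 : faithful (vector_state (rep_vec rho1)) (rep_vna rho1))
    (hfaithful2 : faithful (vector_state (rep_vec rho2)) (rep_vna rho2)) :
  exists pi : (rep_space rho1 -> rep_space rho1) ->
              (rep_space rho2 -> rep_space rho2),
    [/\ vna_morphism (rep_vna rho1) (rep_vna rho2) pi,
        normal_map (rep_vna rho1) (rep_vna rho2) pi
      & forall T, rep_vna rho1 T ->
          vector_state (rep_vec rho2) (pi T) = vector_state (rep_vec rho1) T].
Proof.
have gram b c : ip (rep_map rho1 b) (rep_map rho1 c) = ip (rep_map rho2 b) (rep_map rho2 c).
  by rewrite -!rep_phi.
have [V [W gp]] := gram_pair_exists gram.
have gp' := gram_pair_sym gp.
have [lV nV aV val valW orth orthW] := gp.
have bV : bdd V by exists 1 => // x; rewrite mul1r.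
have VE a t x : S a -> V (rep_res rho1 a t x) = rep_res rho2 a t (V x).
  move=> Sa; apply: (roi_intertwines _ _ _ _ lV bV aV).
  - exact: rep_op_sa (or_introl Sa).
  - exact: rep_resP.
  - exact: rep_op_sa (or_introl Sa).
  - exact: rep_resP.
  - exact: (graph_intertwines_pair hA hS hgrowth gp Sa).
  - exact: (graph_intertwines_pair hA hS hgrowth gp' Sa).
apply: (@intertwiner_isomorphism _ _ _ _ _ _ _ V W) => //.
- by move=> _ [a [t [_ ->]]]; exact: roi_bounded.
- by move=> _ [a [t [_ ->]]]; exact: roi_adj.
- by move=> _ [a [t [_ ->]]]; exact: roi_bounded.
- by move=> _ [a [t [_ ->]]]; exact: roi_adj.
split => //.
(* [V W V = V]: [V] kills the part of [x] orthogonal to the range of [rep_map rho1], and both sides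
   agree on that range, hence on its closure. *)
- move=> x; have [p lp hp] := range_split (rep_map rho1) x.
  have Vx : V x = V p by apply/eqP; rewrite -subr_eq0 -(linB lV) orth.
  rewrite Vx; apply: (@eq_on_limpt _ _ _ (V \o W \o V) V (range (rep_map rho1))) => //.
  + by move=> c u v /=; rewrite lV (gp_lin gp') lV.
  + exists 1 => // u /=; rewrite mul1r (le_trans (nV _))//.
    by rewrite (le_trans (gp_norm gp' _)).
  + by move=> _ [b _ <-] /=; rewrite val valW val.
- by rewrite -!rep_map1 val.
- by rewrite -!rep_map1 valW.
- by move=> _ [a [t [Sa ->]]]; exists (rep_res rho2 a t); [exists a, t|move=> x; exact: VE].
- by move=> _ [a [t [Sa ->]]]; exists (rep_res rho1 a t); [exists a, t|move=> x; exact: VE].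
Qed.
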